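(* Fix an integer $n \geq 2$ and a prime $\ell$, and let $\Delta \geq 0$ be a real number. Suppose that for every $\varepsilon > 0$ there is a constant $C_{n\ell,\varepsilon}$ such that for every integer $D > 1$ at most $C_{n\ell,\varepsilon} D^{\Delta + \varepsilon}$ fields $M/\mathbb{Q}$ of degree $n\ell$ have $D_M = D$. Then for every $\varepsilon > 0$ there is a constant $C_{n,\ell,\varepsilon}$ such that every field $K/\mathbb{Q}$ of degree $n$ satisfies $|\mathrm{Cl}_K[\ell]| \leq C_{n,\ell,\varepsilon} D_K^{\ell\Delta + \varepsilon}$.
   Context: Fields are counted as distinct subfields of a fixed algebraic closure $\overline{\mathbb{Q}}$. For a number field $K$, $D_K = |\mathrm{Disc}\, K/\mathbb{Q}|$, $\mathrm{Cl}_K$ is its ideal class group (written additively), and $\mathrm{Cl}_K[\ell] = \{[\mathfrak{a}] \in \mathrm{Cl}_K : \ell[\mathfrak{a}] = 0\}$. *)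

(* Defs.v *)
From HB Require Import structures.
From mathcomp Require Import all_boot all_order all_algebra all_field.
From mathcomp Require Import all_classical all_reals all_analysis.

Set Implicit Arguments.
Unset Strict Implicit.
Unset Printing Implicit Defensive.

Import Order.TTheory GRing.Theory Num.Theory.

Local Open Scope classical_set_scope.
Local Open Scope ring_scope.

Section NumberField.
Variable K : fieldExtType rat.

Definition ring_of_integers : set K :=
  [set x | integralOver (intr : int -> K) x].

Local Notation OK := ring_of_integers.

Definition field_trace (x : K) : rat :=
  \tr (passmx.mxof (vbasis {:K}) (vbasis {:K}) (amull x)).

Definition integral_basis (w : (\dim {:K}).-tuple K) : Prop :=
  basis_of {:K} w /\
  forall x : K, OK x <->
    exists z : 'I_(\dim {:K}) -> int, x = \sum_i (tnth w i *~ z i).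

(* The value does not depend on the integral basis; the default 0 of [xget] is
   never reached, since every number field has an integral basis and traces of
   algebraic integers are integers. *)
Definition disc : int :=
  xget 0 [set d : int | exists2 w, integral_basis w &
    d%:~R = \det (\matrix_(i, j) field_trace (tnth w i * tnth w j)) :> rat].

Definition abs_disc : nat := `|disc|%N.

Definition frac_ideal : set (set K) :=
  [set I | [/\ exists2 x, I x & x != 0,
               forall x y, I x -> I y -> I (x - y),
               forall a x, OK a -> I x -> I (a * x) &
               exists2 d, OK d /\ d != 0 & forall x, I x -> OK (d * x)]].

Definition ideal_mul (I J : set K) : set K :=
  [set x | exists2 s : seq (K * K),
     forall p, p \in s -> I p.1 /\ J p.2 & x = \sum_(p <- s) p.1 * p.2].

Definition ideal_scale (a : K) (I : set K) : set K := [set a * x | x in I].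

Definition ideal_class (I : set K) : set (set K) :=
  [set ideal_scale a I | a in [set a : K | a != 0]].

Definition class_group : set (set (set K)) :=
  [set ideal_class I | I in frac_ideal].

Definition class_zero : set (set K) := ideal_class OK.

(* The group law of Cl_K as the elementwise product of cosets; on classes of
   ideals it is [I] + [J] = [IJ], see [class_addE]. *)
Definition class_add (c1 c2 : set (set K)) : set (set K) :=
  [set ideal_mul I J | I in c1 & J in c2].

Definition class_mul (m : nat) (c : set (set K)) : set (set K) :=
  iter m (class_add c) class_zero.

Definition class_torsion (m : nat) : set (set (set K)) :=
  [set c | class_group c /\ class_mul m c = class_zero].

Lemma ideal_mul_scale a b (I J : set K) :
  ideal_mul (ideal_scale a I) (ideal_scale b J) =
  ideal_scale (a * b) (ideal_mul I J).
Proof.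
apply/seteqP; split=> x /=.
- case=> s; elim: s x => [|p s IHs] x Hs ->.
    by exists 0; [exists [::]; rewrite ?big_nil | rewrite mulr0 big_nil].
  have [|y [t Ht ->] Ey] := IHs _ _ erefl.
    by move=> q qs; apply: Hs; rewrite inE qs orbT.
  have [[u Iu pu] [v Jv pv]] := Hs p (mem_head _ _).
  exists (\sum_(q <- (u, v) :: t) q.1 * q.2).
    exists ((u, v) :: t) => // q; rewrite inE => /orP[/eqP->//|]; exact: Ht.
  by rewrite !big_cons /= mulrDr Ey -pu -pv mulrACA.
- case=> y [s Hs ->] <-.
  exists [seq (a * p.1, b * p.2) | p <- s].
    move=> q /mapP[p /Hs[Ip Jp] ->] /=; split; [by exists p.1 | by exists p.2].
  by rewrite big_map mulr_sumr; apply: eq_bigr => p _; rewrite /= mulrACA.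
Qed.

Lemma class_addE (I J : set K) :
  class_add (ideal_class I) (ideal_class J) = ideal_class (ideal_mul I J).
Proof.
apply/seteqP; split=> L /=.
- move=> [_ [a a0 <-]] [_ [b b0 <-]] <-.
  by exists (a * b); rewrite /= ?mulf_neq0 // ideal_mul_scale.
- move=> [a a0 <-]; exists (ideal_scale a I); first by exists a.
  exists (ideal_scale 1 J); first by exists 1; rewrite //= oner_neq0.
  by rewrite ideal_mul_scale mulr1.
Qed.

End NumberField.

Arguments ring_of_integers K : clear implicits.
Arguments frac_ideal K : clear implicits.
Arguments class_group K : clear implicits.
Arguments class_zero K : clear implicits.
Arguments class_torsion K m : clear implicits.

(* The fields are subsets of the algebraic closure [algC] of Q, given as images
   of embeddings; isomorphic but distinct subfields are distinct elements. *)
Definition number_fields (d D : nat) : set (set algC) :=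
  [set M | exists (L : fieldExtType rat) (iota : {rmorphism L -> algC}),
     [/\ \dim {:L} = d, abs_disc L = D & M = range iota]].

(* Main.v *)
(* For a class [I] killed by [l], write [I ^ l = (a)]. The field
   [M = K((l a)^(1/l))], embedded in [algC] over a fixed embedding of [K], has
   degree [l] over [K]. It need not be Galois over [K], but it is unramified over
   [K] outside [l], since [(a)] is the [l]-th power of an ideal, while the factor
   [l] of the radicand forces [D_M > 1]. More precisely [D_M] divides
   [(l^(2n) D_K)^l], which leaves [D_K^(o(1))] values of [D_M] by the divisor
   bound, each taken by few fields.
   At most one class gives no such field, and at most [l] classes give the same
   [M], because elements of [M] with [l]-th power in [K] and pairwise ratios
   outside [K] are linearly independent over [K].
   No unique factorization of ideals is needed: the relation [I ^ l = (a)] makes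
   [I] invertible, and for each [m > 1] it lets us change [a] by an [l]-th power
   into an integer [b] prime to [m], so that the discriminant of the order
   generated over the integers of [K] by [(l b)^(1/l)] gives the bound on the
   part of [D_M] supported at the primes dividing [m]. *)
Require Import Defs.
From HB Require Import structures.
From mathcomp Require Import all_boot all_order all_algebra all_field.
From mathcomp Require Import finmap mxtens.
From mathcomp Require Import all_classical all_reals all_analysis.
From mathcomp Require Import ring zify.

Set Implicit Arguments.
Unset Strict Implicit.
Unset Printing Implicit Defensive.

Import Order.TTheory GRing.Theory Num.Theory.

Local Open Scope classical_set_scope.
Local Open Scope ring_scope.

(** * The trace form of a number field *)

Section Trace.
Variable K : fieldExtType rat.
Implicit Types x y : K.

(** Frees [field_trace] from the basis [vbasis] of its definition: expanding each basis in the other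
    and exchanging the sums gives the same diagonal sum. *)
Lemma trace_coord N (b : N.-tuple K) x : basis_of {:K} b ->
  field_trace x = \sum_(i < N) coord b i (x * b`_i).
Proof.
move=> bK; set e := vbasis {:K}; have eK : basis_of {:K} e := vbasisP _.
transitivity (\sum_(i < \dim {:K}) coord e i (x * e`_i)).
  apply: eq_bigr => i _.
  by rewrite !mxE /= passmx.vecof_delta lfunE.
transitivity (\sum_(i < \dim {:K}) \sum_(j < N)
    coord b j (x * e`_i) * coord e i b`_j).
  apply: eq_bigr => i _; rewrite {1}(coord_basis bK (memvf (x * e`_i))).
  by rewrite linear_sum; apply: eq_bigr => j _; rewrite linearZ.
rewrite exchange_big; apply: eq_bigr => j _ /=.
rewrite [in RHS](coord_basis eK (memvf b`_j)) mulr_sumr linear_sum.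
by apply: eq_bigr => i _; rewrite -scalerAr linearZ mulrC.
Qed.

Fact field_trace_linear : linear_for *%R (@field_trace K).
Proof.
move=> a x y; rewrite !(trace_coord _ (vbasisP {:K})) mulr_sumr -big_split.
by apply: eq_bigr => i _; rewrite mulrDl -scalerAl linearP.
Qed.
HB.instance Definition _ := GRing.isLinear.Build rat K rat *%R (@field_trace K)
  field_trace_linear.

Lemma field_trace1 : field_trace (1 : K) = (\dim {:K})%:R.
Proof.
have bK := vbasisP {:K}; rewrite (trace_coord _ bK).
rewrite (eq_bigr (fun=> 1)) ?sumr_const ?card_ord// => i _.
by rewrite mul1r coord_free ?eqxx// (basis_free bK).
Qed.

Lemma dim_field_gt0 : (0 < \dim {:K})%N.
Proof.
rewrite lt0n dimv_eq0; apply/eqP => K0.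
have := memvf (1 : K); rewrite K0 memv0 => /eqP/eqP.
by rewrite oner_eq0.
Qed.

(** Test on [y = x^-1]: the trace of 1 is the degree, nonzero in characteristic 0. *)
Lemma field_trace_nondegenerate x :
  (forall y, field_trace (x * y) = 0) -> x = 0.
Proof.
move=> x0; apply/eqP/contraT => xn0; have := x0 x^-1.
rewrite mulfV// field_trace1 => /eqP; rewrite pnatr_eq0 => /eqP d0.
by have := dim_field_gt0; rewrite d0.
Qed.

Definition mul_mx N (b : N.-tuple K) x : 'M[rat]_N :=
  \matrix_(i, j) coord b j (x * b`_i).

(** Two families are allowed because the discriminant bound for radical extensions pairs [g ^+ t]
    with [g ^+ (l - t)]. *)
Definition trace_form m n (u : 'I_m -> K) (v : 'I_n -> K) : 'M[rat]_(m, n) :=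
  \matrix_(i, j) field_trace (u i * v j).

Section Basis.
Variables (N : nat) (b : N.-tuple K).
Hypothesis bK : basis_of {:K} b.

Lemma coord_nth (i j : 'I_N) : coord b j b`_i = (i == j)%:R.
Proof. by rewrite coord_free ?(basis_free bK)// eq_sym. Qed.

Lemma mul_mxE x (i : 'I_N) : x * b`_i = \sum_j mul_mx b x i j *: b`_j.
Proof.
rewrite {1}(coord_basis bK (memvf (x * b`_i))).
by apply: eq_bigr => j _; rewrite mxE.
Qed.

Fact mul_mx_linear : linear (mul_mx b).
Proof.
move=> a x y; apply/matrixP => i j.
by rewrite !mxE mulrDl -scalerAl linearP.
Qed.

Lemma mul_mxD x y : mul_mx b (x + y) = mul_mx b x + mul_mx b y.
Proof. by rewrite -[x]scale1r mul_mx_linear !scale1r. Qed.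

Lemma mul_mx0 : mul_mx b 0 = 0.
Proof. by apply/matrixP => i j; rewrite !mxE mul0r linear0. Qed.

Lemma mul_mx_alg a : mul_mx b a%:A = a%:M.
Proof.
apply/matrixP => i j; rewrite !mxE -scalerAl mul1r linearZ /=.
by rewrite coord_nth mulr_natr.
Qed.

Lemma mul_mxM x y : mul_mx b (x * y) = mul_mx b x *m mul_mx b y.
Proof.
apply/matrixP => i j; rewrite !mxE -mulrA [y * _]mulrC mulrA (mul_mxE x).
rewrite mulr_suml linear_sum; apply: eq_bigr => k _.
by rewrite -scalerAl linearZ !mxE [b`_k * y]mulrC.
Qed.

Lemma trace_mul_mx x : field_trace x = \tr (mul_mx b x).
Proof. by rewrite (trace_coord _ bK); apply: eq_bigr => i _; rewrite mxE. Qed.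

Lemma field_trace_basis x :
  (forall i : 'I_N, field_trace (x * b`_i) = 0) -> x = 0.
Proof.
move=> x0; apply: field_trace_nondegenerate => y.
rewrite (coord_basis bK (memvf y)) mulr_sumr linear_sum big1// => i _.
by rewrite -scalerAr linearZ /= x0 mulr0.
Qed.

Lemma trace_form_coord m n (u : 'I_m -> K) (v : 'I_n -> K) :
  trace_form u v = (\matrix_(i, j) coord b j (u i))
     *m trace_form (tnth b) (tnth b) *m (\matrix_(i, j) coord b j (v i))^T.
Proof.
apply/matrixP => i j; rewrite mxE.
rewrite {1}(coord_basis bK (memvf (u i))) {1}(coord_basis bK (memvf (v j))).
rewrite mulr_suml linear_sum !mxE.
under [RHS]eq_bigr do rewrite !mxE mulr_suml.
rewrite [RHS]exchange_big; apply: eq_bigr => k _.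
rewrite mulr_sumr linear_sum; apply: eq_bigr => l _.
rewrite -scalerAl -scalerAr !mxE !linearZ /= -!tnth_nth.
by rewrite !mulrA [RHS]mulrAC.
Qed.

Lemma trace_form_basis_unit : \det (trace_form (tnth b) (tnth b)) != 0.
Proof.
apply/det0P => -[v v0 vG]; case/eqP: v0; apply/rowP => i; rewrite mxE.
pose x := \sum_j v 0 j *: b`_j.
have x0 : x = 0.
  apply: field_trace_basis => j.
  move/rowP: vG => /(_ j); rewrite !mxE => <-.
  rewrite mulr_suml linear_sum; apply: eq_bigr => k _.
  by rewrite -scalerAl linearZ /= mxE !(tnth_nth 0).
have := coord_sum_free (fun j => v 0 j) i (basis_free bK).
by rewrite -/x x0 linear0.
Qed.

End Basis.

Lemma trace_form_basis N (b : N.-tuple K) : \dim {:K} = N ->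
  \det (trace_form (tnth b) (tnth b)) != 0 -> basis_of {:K} b.
Proof.
move=> dK G0; rewrite basisEfree size_tuple dK leqnn subvf !andbT.
apply/freeP => k bk i; pose v := \row_j k j.
have /(congr1 (mulmx^~ (invmx (trace_form (tnth b) (tnth b))))) :
    v *m trace_form (tnth b) (tnth b) = 0.
  apply/rowP => j; rewrite !mxE.
  transitivity (field_trace ((\sum_(j < N) k j *: b`_j) * b`_j)).
    rewrite mulr_suml linear_sum; apply: eq_bigr => l _.
    by rewrite -scalerAl linearZ /= !mxE !(tnth_nth 0).
  by rewrite bk mul0r linear0.
rewrite mulmxK ?unitmxE ?unitfE// mul0mx => /rowP/(_ i).
by rewrite !mxE.
Qed.

End Trace.

(** * Integrality over the integers *)

Lemma ratr_Aint_int (q : rat) : (ratr q : algC) \in Aint -> q \is a Num.int.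
Proof.
move=> /(Cint_rat_Aint (Crat_rat q))/intrP[m qm].
suff -> : q = m%:~R by apply: intr_int.
by apply: (fmorph_inj (@ratr algC)); rewrite /= qm ratr_int.
Qed.

Lemma common_denominator (I : finType) (q : I -> rat) :
  exists2 d : int, d != 0 & forall i, q i * d%:~R \is a Num.int.
Proof.
exists (\prod_i denq (q i)); first by apply/prodf_neq0 => i _; apply: denq_neq0.
move=> i; rewrite (bigD1 i)//= intrM mulrA.
by rewrite -{1}(divq_num_den (q i)) divfK ?intq_eq0 ?denq_neq0// rpredM// intr_int.
Qed.

Section Integers.
Variable K : fieldExtType rat.
Local Notation OK := (ring_of_integers K).
Implicit Types x y : K.

Lemma OK_int (m : int) : OK m%:~R.
Proof. exact: (@integral_id _ _ (intmul 1 : {rmorphism int -> K})). Qed.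

Lemma OK0 : OK 0. Proof. exact: (OK_int 0). Qed.
Lemma OK1 : OK 1. Proof. exact: (OK_int 1). Qed.

Lemma OKD x y : OK x -> OK y -> OK (x + y).
Proof. exact: (@integral_add _ _ (intmul 1 : {rmorphism int -> K})). Qed.

Lemma OKB x y : OK x -> OK y -> OK (x - y).
Proof. exact: (@integral_sub _ _ (intmul 1 : {rmorphism int -> K})). Qed.

Lemma OKM x y : OK x -> OK y -> OK (x * y).
Proof. exact: (@integral_mul _ _ (intmul 1 : {rmorphism int -> K})). Qed.

Lemma OKMz x (m : int) : OK x -> OK (x *~ m).
Proof. by move=> Ox; rewrite -mulrzr; apply: OKM (OK_int m). Qed.

Lemma OKX x m : OK x -> OK (x ^+ m).
Proof.
by move=> Ox; elim: m => [|m IHm]; [exact: OK1 | rewrite exprS; apply: OKM].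
Qed.

Lemma OK_sum (I : Type) (r : seq I) (P : pred I) (F : I -> K) :
  (forall i, P i -> OK (F i)) -> OK (\sum_(i <- r | P i) F i).
Proof. by move=> OF; apply: (big_ind _ OK0 OKD). Qed.

Lemma OK_root_exp x m : (0 < m)%N -> OK (x ^+ m) -> OK x.
Proof.
move=> m0 Ox; pose f := (intmul 1 : {rmorphism int -> K}).
apply: (@integral_root_monic _ _ f _ ('X^m - (x ^+ m)%:P)).
- exact: monicXnsubC.
- by rewrite /root !hornerE subrr.
- apply/integral_poly => i; rewrite coefB coefXn coefC.
  by apply: OKB; [case: (i == m) | case: (i == 0%N)]; rewrite //;
    (apply: OK1 || apply: OK0).
Qed.

(** The relations make [x] an eigenvalue of an integer matrix, with the basis itself as nonzero
    eigenvector, so [x] is a root of a monic integer characteristic polynomial. *)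
Lemma OK_int_matrix N (b : N.-tuple K) (B : 'M[int]_N) x :
  basis_of {:K} b ->
  (forall i : 'I_N, x * b`_i = \sum_(j < N) b`_j *~ B i j) -> OK x.
Proof.
move=> bK xB; exists (char_poly B^T); first exact: char_poly_monic.
rewrite (map_char_poly (intmul 1 : {rmorphism int -> K})).
rewrite -eigenvalue_root_char; apply/eigenvalueP; exists (\row_i b`_i).
  apply/rowP => i; rewrite !mxE xB; apply: eq_bigr => j _.
  by rewrite !mxE mulrzr.
apply/eqP => b0; have := dim_field_gt0 K; rewrite (size_basis bK).
move=> N0; have := basis_not0 bK (mem_nth 0 (_ : (Ordinal N0 < size b)%N)).
rewrite size_tuple N0 => /(_ isT).
by move/rowP: b0 => /(_ (Ordinal N0)); rewrite !mxE => ->; rewrite eqxx.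
Qed.

(** A common denominator [d] of the matrix of multiplication by [x] works: [x *~ d] then acts by an
    integer matrix. *)
Lemma OK_denominator x : exists2 d : int, d != 0 & OK (x *~ d).
Proof.
pose b := vbasis {:K}; have bK : basis_of {:K} b := vbasisP _.
have [d d0 dA] := @common_denominator ('I_(\dim {:K}) * 'I_(\dim {:K}))%type
  (fun p => mul_mx b x p.1 p.2).
exists d => //.
apply: (@OK_int_matrix _ b
  (\matrix_(i, j) Num.floor (mul_mx b x i j * d%:~R))) => // i.
rewrite mulrzAl mul_mxE// mulrz_suml; apply: eq_bigr => j _; rewrite !mxE.
have := dA (i, j); rewrite intrEfloor /= mxE => /eqP fl.
by rewrite -[in RHS]scaler_int fl scalerMzl -mulrzr.
Qed.

(** A polynomial in [x] acts on an eigenvector through the same polynomial in the eigenvalue, so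
    every eigenvalue is a root of any integer polynomial vanishing at [x]. *)
Lemma eigen_mul_mx N (b : N.-tuple K) x (v : 'rV[algC]_N) a (p : {poly int}) :
  basis_of {:K} b -> v *m map_mx ratr (mul_mx b x) = a *: v ->
  v *m map_mx ratr (mul_mx b (map_poly intr p).[x])
    = (map_poly intr p).[a] *: v.
Proof.
move=> bK va; elim/poly_ind: p => [|p c IHp].
  by rewrite !rmorph0 !horner0 mul_mx0 rmorph0 mulmx0 scale0r.
rewrite !rmorphD !rmorphM /= !map_polyX !map_polyC !hornerE /=.
rewrite mul_mxD// mul_mxM// map_mxD map_mxM mulmxDr mulmxA IHp.
rewrite -scalemxAl va scalerA scalerDl; congr (_ + _).
have -> : c%:~R = (c%:~R : rat)%:A :> K by rewrite scaler_int.
by rewrite mul_mx_alg// map_scalar_mx /= ratr_int mul_mx_scalar.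
Qed.

(** The trace is the sum of the eigenvalues in [algC] of multiplication by [x]; these are algebraic
    integers, and a rational algebraic integer is an integer. *)
Lemma field_trace_int x : OK x -> field_trace x \is a Num.int.
Proof.
move=> [p p1 px]; pose b := vbasis {:K}.
have bK : basis_of {:K} b := vbasisP _.
rewrite (trace_mul_mx bK); apply: ratr_Aint_int; rewrite -trace_map_mx.
set A := map_mx _ _.
have [rs Ars] := closed_field_poly_normal (char_poly A).
rewrite (monicP (char_poly_monic A)) scale1r in Ars.
have rsAint z : z \in rs -> z \in Aint.
  move=> zrs; have : root (char_poly A) z by rewrite Ars root_prod_XsubC.
  rewrite -eigenvalue_root_char => /eigenvalueP[v va v0].
  apply: (@root_monic_Aint (map_poly intr p)).
  - have := eigen_mul_mx p bK va; rewrite (rootP px).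
    rewrite mul_mx0 rmorph0 mulmx0 => /esym/eqP.
    by rewrite scaler_eq0 (negPf v0) orbF.
  - exact: monic_map.
  - by apply/polyOverP => i; rewrite coef_map /= intr_int.
have rsN : size rs = \dim {:K}.
  apply: succn_inj; rewrite -(size_prod_XsubC _ id) -Ars size_char_poly.
  by [].
have : (\prod_(z <- rs) ('X - z%:P))`_(size rs).-1 = - \tr A.
  by rewrite rsN -Ars char_poly_trace ?dim_field_gt0.
rewrite coefPn_prod_XsubC; last by rewrite rsN -lt0n dim_field_gt0.
by move/oppr_inj <-; rewrite big_seq rpred_sum.
Qed.

Lemma OK_rat_int (q : rat) : OK q%:A -> q \is a Num.int.
Proof.
move=> [p p1 pq]; apply: ratr_Aint_int.
apply: (@root_monic_Aint (map_poly intr p)); first last.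
- by apply/polyOverP => i; rewrite coef_map /= intr_int.
- exact: monic_map.
suff : root (map_poly intr p) q.
  move/(rmorph_root (@ratr algC)); rewrite -map_poly_comp /=.
  by under eq_map_poly do rewrite /= ratr_int.
move: pq; rewrite -(fmorph_root (in_alg K)) -map_poly_comp /=.
by rewrite (eq_map_poly (g := intr))// => c; apply: (rmorph_int (in_alg K)).
Qed.
End Integers.

(** * Integral bases and the discriminant *)

Lemma int_matrixP m n (A : 'M[rat]_(m, n)) :
  (forall i j, A i j \is a Num.int) ->
  map_mx intr (map_mx Num.floor A) = A.
Proof.
move=> Aint; apply/matrixP => i j; rewrite !mxE; apply/eqP.
by rewrite -intrEfloor.
Qed.

Lemma det_rat_int n (A : 'M[rat]_n) :
  (forall i j, A i j \is a Num.int) -> \det A \is a Num.int.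
Proof. by move=> /int_matrixP <-; rewrite det_map_mx intr_int. Qed.

Section IntegralBasis.
Variable K : fieldExtType rat.
Local Notation OK := (ring_of_integers K).
Implicit Types x y : K.

Lemma trace_form_int m n (u : 'I_m -> K) (v : 'I_n -> K) i j :
  OK (u i) -> OK (v j) -> trace_form u v i j \is a Num.int.
Proof. by move=> Ou Ov; rewrite mxE; apply/field_trace_int/OKM. Qed.

Lemma integral_basisP (w : (\dim {:K}).-tuple K) : basis_of {:K} w ->
  (forall i, OK (tnth w i)) ->
  (forall x i, OK x -> coord w i x \is a Num.int) -> integral_basis w.
Proof.
move=> wK Ow cw; split=> // x; split=> [Ox|[z ->]]; last first.
  by apply: OK_sum => i _; apply: OKMz.
exists (fun i => Num.floor (coord w i x)).
rewrite {1}(coord_basis wK (memvf x)); apply: eq_bigr => i _.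
have := cw x i Ox; rewrite intrEfloor => /eqP fl.
by rewrite -scaler_int fl (tnth_nth 0).
Qed.

Lemma integral_basis_OK (w : (\dim {:K}).-tuple K) i :
  integral_basis w -> OK (tnth w i).
Proof.
move=> [wK wO]; apply/wO; exists (fun j => (j == i)%:R).
rewrite (bigD1 i)//= eqxx big1 ?addr0// => j /negPf ->; exact: mulr0z.
Qed.

Lemma integral_basis_coord (w : (\dim {:K}).-tuple K) i x :
  integral_basis w -> OK x -> coord w i x \is a Num.int.
Proof.
move=> [wK wO] /wO[z ->]; rewrite linear_sum rpred_sum// => j _.
by rewrite raddfMz rpredMz//= (tnth_nth 0) (coord_nth wK) rpred_nat.
Qed.

(** Only row [i] differs from the identity matrix, so expansion along column [i] leaves one term.
    This measures the change of the Gram determinant when one basis vector is replaced. *)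
Lemma det_coord_replace (w w' : (\dim {:K}).-tuple K) i : basis_of {:K} w ->
  (forall r, r != i -> tnth w' r = tnth w r) ->
  \det (\matrix_(r, s) coord w s (tnth w' r)) = coord w i (tnth w' i).
Proof.
move=> wK w'w; set P := \matrix_(_, _) _.
rewrite (expand_det_col P i) (bigD1 i)//= big1 ?addr0 => [|r ri]; last first.
  by rewrite !mxE w'w// (tnth_nth 0) (coord_nth wK) (negPf ri) mul0r.
rewrite mxE /cofactor -signr_odd addnn odd_double mul1r.
suff -> : row' i (col' i P) = 1%:M by rewrite det1 mulr1.
apply/matrixP => r s; rewrite !mxE w'w; last by rewrite eq_sym neq_lift.
by rewrite (tnth_nth 0) (coord_nth wK) (inj_eq lift_inj).
Qed.

(* Among the bases made of integers, one with least discriminant is integral: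
   an integer with a coordinate that is not in [int] would yield a basis with a
   smaller one. *)
Lemma integral_basis_exists : exists w, @integral_basis K w.
Proof.
set N := \dim {:K}.
pose G (w : N.-tuple K) := \det (trace_form (tnth w) (tnth w)).
pose P m := `[< exists w : N.-tuple K,
  [/\ forall i, OK (tnth w i), basis_of {:K} w & `|G w| = m%:R] >].
have Gnat (w : N.-tuple K) : (forall i, OK (tnth w i)) ->
    exists m : nat, `|G w| = m%:R.
  move=> Ow; have /intrP[m Gm] : G w \is a Num.int.
    by apply: det_rat_int => i j; apply: trace_form_int.
  by exists `|m|%N; rewrite Gm -intr_norm -abszE.
have [m Pm] : exists m, P m.
  have /choice[d dP] (i : 'I_N) : exists d : int,
      d != 0 /\ OK (tnth (vbasis {:K}) i *~ d).
    by have [d d0 dO] := OK_denominator (tnth (vbasis {:K}) i); exists d.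
  pose w := [tuple tnth (vbasis {:K}) i *~ d i | i < N].
  have Ow i : OK (tnth w i) by rewrite tnth_mktuple; case: (dP i).
  have [m Gm] := Gnat w Ow; exists m; apply/asboolP; exists w; split=> //.
  rewrite basisEfree size_tuple leqnn subvf !andbT.
  apply/freeP => k kw i; have [di _] := dP i.
  have /freeP/(_ (fun i => k i * (d i)%:~R)) k0 := basis_free (vbasisP {:K}).
  suff /eqP : k i * (d i)%:~R = 0.
    by rewrite mulf_eq0 intq_eq0 (negPf di) orbF => /eqP.
  apply: k0; rewrite -[RHS]kw; apply: eq_bigr => j _.
  by rewrite -!tnth_nth tnth_mktuple -scalerA scaler_int.
have [{Pm}m] := ex_minnP (ex_intro _ m Pm).
move=> /asboolP[w [Ow wK Gm] minm]; exists w; apply: integral_basisP => // x i Ox.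
(* Subtracting the integer part of the bad coordinate leaves [0 < c < 1], and putting [x'] in place
   of the [i]-th vector multiplies the Gram determinant by [c ^+ 2]. *)
apply/contraT => xi; set f := Num.floor (coord w i x).
pose x' := x - tnth w i *~ f.
pose w' := [tuple if r == i then x' else tnth w r | r < N].
have Ow' r : OK (tnth w' r).
  by rewrite tnth_mktuple; case: eqP => _ //; apply/OKB/OKMz.
set c := coord w i x - f%:~R.
have ci : coord w i (tnth w' i) = c.
  rewrite tnth_mktuple eqxx linearB raddfMz /= (tnth_nth 0) (coord_nth wK).
  by rewrite eqxx.
have GE : G w' = c ^+ 2 * G w.
  rewrite /G (trace_form_coord wK) !det_mulmx det_tr.
  rewrite (@det_coord_replace _ _ i) ?ci//; last first.
    by move=> r ri; rewrite tnth_mktuple (negPf ri).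
  by rewrite mulrAC expr2.
have c0 : 0 < c.
  rewrite lt_def subr_ge0 floor_le andbT subr_eq0 eq_sym.
  by move: xi; rewrite intrEfloor.
have c1 : c < 1 by rewrite ltrBlDl -(intrD _ f 1) floorD1_gt.
have G0 : G w != 0 by exact: trace_form_basis_unit.
have [m' Gm'] := Gnat w' Ow'.
have : P m'.
  apply/asboolP; exists w'; split=> //; apply: trace_form_basis => //.
  by rewrite -/(G w') GE mulf_neq0// expf_neq0// gt_eqF.
move=> /minm; rewrite leqNgt => /negP; case.
rewrite -(ltr_nat rat) -Gm' -Gm GE normrM gtr_pMl ?normr_gt0//.
by rewrite ger0_norm ?sqr_ge0// expr_lt1// ltW.
Qed.

Lemma disc_spec : exists2 w, @integral_basis K w &
  (disc K)%:~R = \det (trace_form (tnth w) (tnth w)).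
Proof.
have [w wB] := integral_basis_exists.
have /intrP[d dE] : \det (trace_form (tnth w) (tnth w)) \is a Num.int.
  by apply: det_rat_int => i j; apply: trace_form_int; apply: integral_basis_OK.
rewrite /disc; set D := [set _ | _].
have : D (xget 0 D) by apply: xgetPex; exists d; exists w.
by case=> w' w'B w'D; exists w'.
Qed.

Lemma disc_neq0 : disc K != 0.
Proof.
have [w [wK _] wD] := disc_spec.
by rewrite -(intq_eq0 (disc K)) wD; apply: trace_form_basis_unit.
Qed.

Lemma abs_disc_gt0 : (0 < abs_disc K)%N.
Proof. by rewrite absz_gt0 disc_neq0. Qed.

(** Both families have integer coordinates in an integral basis, so the determinant is [disc K]
    times two integer coordinate determinants. *)
Lemma disc_dvd_trace_form N (u v : 'I_N -> K) : \dim {:K} = N ->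
  (forall i, OK (u i)) -> (forall i, OK (v i)) ->
  exists k : int, \det (trace_form u v) = (k * disc K)%:~R.
Proof.
move=> dK; case: N / dK u v => u v Ou Ov.
have [w wB wD] := disc_spec; have [wK _] := wB.
rewrite (trace_form_coord wK) !det_mulmx det_tr -wD.
have cint (t : 'I_(\dim {:K}) -> K) : (forall i, OK (t i)) ->
    \det (\matrix_(i, j) coord w j (t i)) \is a Num.int.
  by move=> Ot; apply: det_rat_int => i j; rewrite mxE; apply: integral_basis_coord.
have /intrP[k ->] := cint u Ou; have /intrP[l ->] := cint v Ov.
by exists (k * l); rewrite mulrAC !intrM.
Qed.

(** Discriminant 1 or -1 makes the ring of integers its own dual for the trace form: the adjugate of
    the Gram matrix recovers integer coordinates from integer traces. *)
Lemma OK_unimodular x : abs_disc K = 1%N ->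
  (forall z, OK z -> field_trace (x * z) \is a Num.int) -> OK x.
Proof.
move=> D1 xint; have [w wB wD] := disc_spec; have [wK _] := wB.
set G := trace_form _ _ in wD.
have Gint i j : G i j \is a Num.int.
  by apply: trace_form_int; apply: integral_basis_OK.
pose c := \row_i coord w i x.
have cG i : (c *m G) 0 i \is a Num.int.
  rewrite mxE; suff -> : \sum_j c 0 j * G j i = field_trace (x * tnth w i).
    by apply/xint/integral_basis_OK.
  rewrite [in RHS](coord_basis wK (memvf x)) mulr_suml linear_sum.
  apply: eq_bigr => j _.
  by rewrite !mxE -scalerAl linearZ /= !(tnth_nth 0).
have cE : (disc K)%:~R *: c = c *m G *m \adj G.
  by rewrite -mulmxA mul_mx_adj mul_mx_scalar wD.
have cint i : (disc K)%:~R * coord w i x \is a Num.int.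
  move/rowP: cE => /(_ i); rewrite [LHS]mxE [c _ _]mxE => ->.
  rewrite mxE rpred_sum// => j _; rewrite rpredM//.
  rewrite -(int_matrixP Gint) -map_mx_adj mxE; exact: intr_int.
rewrite (coord_basis wK (memvf x)); apply: OK_sum => i _.
have /intrP[z zE] : coord w i x \is a Num.int.
  have := cint i; move: D1; rewrite /abs_disc; case: (disc K) => [[|[|]]|[|]]//= _.
    by rewrite mul1r.
  by rewrite mulN1r rpredN.
by rewrite zE scaler_int; apply: OKMz; rewrite -tnth_nth; apply: integral_basis_OK.
Qed.

Section IntMulMx.
Variable w : (\dim {:K}).-tuple K.
Hypothesis wB : integral_basis w.

(** The floor loses nothing when [x] is integral and [w] is an integral basis, since the entries are
    then integers. *)
Definition int_mul_mx x : 'M[int]_(\dim {:K}) := map_mx Num.floor (mul_mx w x).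

Lemma int_mul_mxE x : OK x -> map_mx intr (int_mul_mx x) = mul_mx w x.
Proof.
move=> Ox; apply: int_matrixP => i j; rewrite mxE.
apply: integral_basis_coord => //; apply: OKM => //.
by rewrite -tnth_nth; apply: integral_basis_OK.
Qed.

Lemma intr_mx_inj n : injective (fun A : 'M[int]_n => map_mx intr A : 'M[rat]_n).
Proof.
move=> A B /matrixP AB; apply/matrixP => i j.
by have := AB i j; rewrite !mxE => /intr_inj.
Qed.

Lemma int_mul_mxD x y : OK x -> OK y ->
  int_mul_mx (x + y) = int_mul_mx x + int_mul_mx y.
Proof.
move=> Ox Oy; apply: intr_mx_inj; rewrite raddfD /= !int_mul_mxE ?mul_mxD//.
exact: OKD.
Qed.

Lemma int_mul_mxM x y : OK x -> OK y ->
  int_mul_mx (x * y) = int_mul_mx x *m int_mul_mx y.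
Proof.
move=> Ox Oy; apply: intr_mx_inj; rewrite map_mxM !int_mul_mxE//; last exact: OKM.
by apply: mul_mxM; case: wB.
Qed.

Lemma int_mul_mx_int (m : int) : int_mul_mx m%:~R = m%:M.
Proof.
apply: intr_mx_inj; rewrite int_mul_mxE; last exact: OK_int.
have -> : m%:~R = (m%:~R : rat)%:A :> K by rewrite scaler_int.
by rewrite mul_mx_alg ?map_scalar_mx//; case: wB.
Qed.

Lemma field_trace_int_mul_mx x : OK x ->
  field_trace x = (\tr (int_mul_mx x))%:~R.
Proof.
move=> Ox; rewrite (@trace_mul_mx _ _ w); last by case: wB.
by rewrite -int_mul_mxE// (trace_map_mx (intmul 1 : {rmorphism int -> rat})).
Qed.

End IntMulMx.
End IntegralBasis.

(** * Congruences modulo [m] in the ring of integers *)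

Section Congruence.
Variables (K : fieldExtType rat) (m : nat).
Hypothesis m_gt0 : (0 < m)%N.
Local Notation OK := (ring_of_integers K).
Implicit Types a b c x y z : K.

Definition cong a b := exists2 t, OK t & a - b = t *+ m.

Lemma congxx a : cong a a.
Proof. by exists 0; [exact: OK0 | rewrite subrr mul0rn]. Qed.

Lemma congD a b a' b' : cong a b -> cong a' b' -> cong (a + a') (b + b').
Proof.
move=> [t Ot tE] [t' Ot' t'E]; exists (t + t'); first exact: OKD.
by rewrite mulrnDl -tE -t'E addrACA opprD.
Qed.

Lemma congN a b : cong a b -> cong (- a) (- b).
Proof.
move=> [t Ot tE]; exists (- t); last by rewrite mulNrn -tE opprB opprK addrC.
by rewrite -sub0r; apply: OKB; [exact: OK0 |].
Qed.

Lemma congB a b a' b' : cong a b -> cong a' b' -> cong (a - a') (b - b').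
Proof. by move=> ab /congN; apply: congD. Qed.

Lemma cong_sym a b : cong a b -> cong b a.
Proof. by move=> /congN [t Ot tE]; exists t => //; rewrite -tE opprK addrC. Qed.

Lemma cong_trans b a c : cong a b -> cong b c -> cong a c.
Proof.
by move=> ab bc; have := congB (congD ab bc) (congxx b); rewrite addrK addrC addKr.
Qed.

Lemma congMl c a b : OK c -> cong a b -> cong (c * a) (c * b).
Proof.
move=> Oc [t Ot tE]; exists (c * t); first exact: OKM.
by rewrite -mulrBr tE mulrnAr.
Qed.

Lemma congMr c a b : OK c -> cong a b -> cong (a * c) (b * c).
Proof. by move=> Oc; rewrite ![_ * c]mulrC; apply: congMl. Qed.

Lemma congM a b a' b' : OK a -> OK b' ->
  cong a b -> cong a' b' -> cong (a * a') (b * b').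
Proof.
move=> Oa Ob' ab ab'; apply: (@cong_trans (a * b')); [exact: congMl|exact: congMr].
Qed.

Lemma cong_sum0 (I : Type) (r : seq I) (P : pred I) (F : I -> K) :
  (forall i, P i -> cong (F i) 0) -> cong (\sum_(i <- r | P i) F i) 0.
Proof.
apply: (big_ind (cong^~ 0)) => [|a b a0 b0]; first exact: congxx.
by rewrite -[0]addr0; apply: congD.
Qed.

(** Coordinates in an integral basis, reduced modulo [m], stand in for the finite quotient ring. *)
Lemma finite_residues : exists (F : finType) (r : K -> F),
  forall a b, OK a -> OK b -> r a = r b <-> cong a b.
Proof.
have [w wB _] := disc_spec K; have [wK wO] := wB.
pose z a i := Num.floor (coord w i a).
(* [m.-1.+1] is [m], written as a successor so that [inord] applies. *)
pose r a : {ffun 'I_(\dim {:K}) -> 'I_m.-1.+1} :=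
  [ffun i => inord `|(z a i %% m)%Z|%N].
exists _, r => a b Oa Ob.
have zE c i : OK c -> coord w i c = (z c i)%:~R.
  by move=> /(integral_basis_coord i wB); rewrite intrEfloor => /eqP.
have m0 : (m : int) != 0 by rewrite -lt0n.
have modE c i : (`|(z c i %% m)%Z|%N < m.-1.+1)%N.
  rewrite prednK// -ltz_nat gez0_abs ?modz_ge0//.
  by rewrite ltz_mod.
split=> [/ffunP rab|[t Ot tE]].
- have /choice[q qP] i : exists q : int, z a i - z b i = q * m.
    apply/dvdzP; rewrite -eqz_mod_dvd.
    have := rab i; rewrite !ffunE => /(congr1 (@nat_of_ord _)).
    rewrite !inordK ?modE// => /(congr1 Posz).
    by rewrite !gez0_abs ?modz_ge0// => ->.
  exists (\sum_i tnth w i *~ q i).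
    by apply: OK_sum => i _; apply/OKMz/integral_basis_OK.
  rewrite (coord_basis wK (memvf (a - b))) -sumrMnl; apply: eq_bigr => i _.
  rewrite linearB /= !zE// -intrB qP scaler_int -tnth_nth.
  by rewrite mulrzA pmulrn.
- apply/ffunP => i; rewrite !ffunE; congr (inord `|_|%N).
  apply/eqP; rewrite eqz_mod_dvd; apply/dvdzP; exists (z t i).
  apply: (@intr_inj rat); rewrite intrB -!zE// -linearB tE /=.
  by rewrite raddfMn /= zE// intrM -mulr_natr.
Qed.

(** Finitely many residues force the powers of [x] to be periodic, of some period [d], from some
    exponent [i] on; an exponent that is at least [i] and a multiple of [d] gives an idempotent. *)
Lemma OK_idempotent_power x : OK x ->
  exists2 N, (0 < N)%N & cong (x ^+ N * x ^+ N) (x ^+ N).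
Proof.
move=> Ox; have [F [r rP]] := finite_residues.
pose f (i : 'I_#|F|.+1) := r (x ^+ i).
have /injectivePn[i [j ij fij]] : ~~ injectiveb f.
  by apply/injectiveP => /leq_card; rewrite card_ord ltnn.
wlog lt_ij : i j ij fij / (i < j)%N.
  move=> H; have [/H|/H|/val_inj ji] := ltngtP i j; first exact.
    by apply; rewrite // eq_sym.
  by rewrite ji eqxx in ij.
have xij : cong (x ^+ i) (x ^+ j) by apply/rP => //; apply: OKX.
pose d := (j - i)%N; have d0 : (0 < d)%N by rewrite subn_gt0.
have step k : (i <= k)%N -> cong (x ^+ k) (x ^+ (k + d)).
  move=> ik; have := congMr (OKX (k - i) Ox) xij.
  by rewrite -!exprD subnKC// addnC /d addnBA ?(ltnW lt_ij)// addnBAC// addnC.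
have steps q k : (i <= k)%N -> cong (x ^+ k) (x ^+ (k + q * d)).
  move=> ik; elim: q => [|q IHq]; first by rewrite mul0n addn0; apply: congxx.
  apply: cong_trans IHq _.
  rewrite (_ : k + q.+1 * d = k + q * d + d)%N; last by rewrite mulSn addnCA addnC.
  apply: step.
  by rewrite (leq_trans ik)// leq_addr.
(* The successor keeps the exponent positive even when [i] is 0. *)
exists (i.+1 * d)%N; first by rewrite muln_gt0.
rewrite -exprD; apply/cong_sym/steps.
by rewrite (leq_trans (leqnSn i))// leq_pmulr.
Qed.

Definition nilpotent_mod x := exists N, cong (x ^+ N) 0.

(** Every term of the expansion of [(x + y) ^+ (M + N)] contains [x ^+ M] or [y ^+ N]. *)
Lemma nilpotent_modD x y : OK x -> OK y ->
  nilpotent_mod x -> nilpotent_mod y -> nilpotent_mod (x + y).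
Proof.
move=> Ox Oy [M xM] [N yN]; exists (M + N)%N.
rewrite exprDn; apply: cong_sum0 => i _.
rewrite -mulr_natr -[X in cong _ X](mul0r ('C(M + N, i)%:R : K)).
apply: congMr; first exact: (OK_int _ 'C(M + N, i)).
have [iN|Ni] := leqP N i.
  rewrite -(subnKC iN) exprD mulrCA -[X in cong _ X](mul0r
    (x ^+ (M + N - (N + (i - N))) * y ^+ (i - N))).
  by apply: congMr => //; apply: OKM; apply: OKX.
have -> : (M + N - i = M + (N - i))%N by rewrite addnBA// ltnW.
rewrite exprD -mulrA -[X in cong _ X](mul0r (x ^+ (N - i) * y ^+ i)).
by apply: congMr => //; apply: OKM; apply: OKX.
Qed.

Lemma nilpotent_mod_sum (s : seq K) : (forall x, x \in s -> OK x) ->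
  (forall x, x \in s -> nilpotent_mod x) -> nilpotent_mod (\sum_(x <- s) x).
Proof.
elim: s => [|x s IHs] Os ns.
  by exists 1%N; rewrite big_nil expr1; apply: congxx.
rewrite big_cons; apply: nilpotent_modD.
- by apply: Os; rewrite mem_head.
- by rewrite big_seq; apply: OK_sum => y ys; apply: Os; rewrite inE ys orbT.
- by apply: ns; rewrite mem_head.
- by apply: IHs => y ys; [apply: Os | apply: ns]; rewrite inE ys orbT.
Qed.

Variables (I J : K -> Prop).
Hypotheses (I0 : I 0) (J0 : J 0).
Hypotheses (ID : forall x y, I x -> I y -> I (x + y))
  (JD : forall x y, J x -> J y -> J (x + y)).
Hypotheses (IM : forall a x, OK a -> I x -> I (a * x))
  (JM : forall a x, OK a -> J x -> J (a * x)).
Hypothesis IJ : forall x y, I x -> J y -> OK (x * y).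
Variable s : seq (K * K).
Hypothesis Is : forall p, p \in s -> I p.1 /\ J p.2.
Hypothesis s1 : \sum_(p <- s) p.1 * p.2 = 1.

(* If [e = xy] is idempotent modulo [m] and not 1, then [1 - e] is a sum of
   elements [(1 - e) p.1 p.2], one of which is not nilpotent; a power of it is
   a nonzero idempotent [e'] orthogonal to [e], and [e + e'] is again a product
   of an element of [I] and one of [J]. *)
Lemma enlarge_idempotent x y (e := x * y) : I x -> J y ->
  cong (e * e) e -> ~ cong e 1 ->
  exists x' y' e', [/\ I x', J y', cong (x' * y') (e + e') & OK e'] /\
    [/\ cong (e' * e') e', cong (e * e') 0 & ~ cong e' 0].
Proof.
move=> Ix Jy ee e1; have Oe : OK e by exact: IJ.
pose f := 1 - e; have Of : OK f by apply: OKB => //; exact: OK1.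
have ef : cong (e * f) 0.
  by rewrite mulrBr mulr1 -[X in cong _ X](subrr e); apply: congB (congxx _) ee.
have ff : cong (f * f) f.
  rewrite {1}/f mulrBl mul1r -[X in cong _ X]subr0; apply: congB ef; exact: congxx.
have [p ps np] : exists2 p, p \in s & ~ nilpotent_mod (f * (p.1 * p.2)).
  apply/not_exists2P => nil; apply: e1.
  have [N fN] : nilpotent_mod f.
    rewrite -[f]mulr1 -s1 mulr_sumr.
    rewrite (eq_bigr (fun p : K * K => id (f * (p.1 * p.2))))//.
    rewrite -(big_map (fun p : K * K => f * (p.1 * p.2)) predT id).
    apply: nilpotent_mod_sum => z /mapP[p ps ->].
      by have [Ip Jp] := Is ps; apply/OKM/IJ.
    by have [//|/contrapT] := nil p.
  have fE k : cong (f ^+ k.+1) f.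
    elim: k => [|k IHk]; first exact: congxx.
    by rewrite exprS; apply: cong_trans ff; apply: congMl.
  have f0 : cong f 0.
    apply: cong_trans (cong_sym (fE N)) _.
    by rewrite exprS -[X in cong _ X](mulr0 f); apply: congMl.
  have := congB (congxx 1) f0; rewrite subr0 /f opprB addrC subrK.
  by move=> h; apply: h.
have [Ip Jp] := Is ps; set z := f * (p.1 * p.2) in np.
have Oz : OK z by apply/OKM/IJ.
have [[|N] // _ zz] := OK_idempotent_power Oz.
pose e' := z ^+ N.+1; have Oe' : OK e' by exact: OKX.
pose x' := f * p.1; pose y' := z ^+ N * p.2.
have Ix' : I x' by exact: IM.
have Jy' : J y' by apply: JM => //; apply: OKX.
have x'y' : x' * y' = e'.
  by rewrite /x' /y' /e' exprS /z mulrACA [LHS]mulrAC.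
have ee' : cong (e * e') 0.
  rewrite (_ : e * e' = e * f * (p.1 * y')); last by rewrite -x'y' /x' !mulrA.
  rewrite -[X in cong _ X](mul0r (p.1 * y')).
  by apply: congMr => //; apply: IJ.
exists (e * x + e' * x'), (e * y + e' * y'), e'; split; split=> //.
- by apply: ID; apply: IM.
- by apply: JD; apply: JM.
(* The cross terms carry the factor [e * e'], which vanishes modulo [m]; the other two terms reduce
   to [e] and [e'] by idempotence. *)
- have -> : (e * x + e' * x') * (e * y + e' * y') =
      (e * e * e + e' * e' * e') + e * e' * (x * y' + x' * y).
    rewrite -[e * e * e]/(e * e * (x * y)).
    transitivity (e * e * (x * y) + e' * e' * (x' * y') +
      e * e' * (x * y' + x' * y)); last by rewrite x'y'.
    by ring.
  rewrite -[X in cong _ X]addr0; apply: congD.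
    apply: congD; apply: cong_trans (congMr _ _) _ => //; first exact: ee.
    by [].
    exact: zz.
    exact: zz.
  rewrite -[X in cong _ X](mul0r (x * y' + x' * y)); apply: congMr => //.
  by apply: OKD; apply: IJ.
- by move=> e'0; apply: np; exists N.+1.
Qed.

(** Starting from the idempotent 0, the product [x * y] is enlarged until it is 1 modulo [m]. This
    stops because the residues of the multiples of the idempotent, counted by [mu], grow strictly
    inside a finite set. *)
Lemma coprime_pair_mod : exists x y, [/\ I x, J y & cong (x * y) 1].
Proof.
have [F [r rP]] := finite_residues.
pose mu e := #|[pred c : F | `[< exists2 t, OK t & r (e * t) = c >]]|.
have H k : (exists x y, [/\ I x, J y & cong (x * y) 1]) \/
    exists x y, [/\ I x, J y, cong (x * y * (x * y)) (x * y) &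
      (k <= mu (x * y)%R)%N].
  elim: k => [|k [|[x [y [Ix Jy ee kmu]]]]]; [right|by left|].
    by exists 0, 0; rewrite !mul0r; split=> //; apply: congxx.
  set e := x * y in ee kmu *; have Oe : OK e by exact: IJ.
  have [e1|e1] := pselect (cong e 1); first by left; exists x, y.
  right; have [x' [y' [e' [[Ix' Jy' xy' Oe'] [ee' e0 e'0]]]]] :=
    enlarge_idempotent Ix Jy ee e1.
  exists x', y'; set e2 := x' * y' in xy' *.
  have Oe2 : OK e2 by exact: IJ.
  have e2e : cong (e2 * e) e.
    apply: (@cong_trans ((e + e') * e)); first exact: congMr.
    rewrite mulrDl -[X in cong _ X]addr0; apply: congD => //.
    by rewrite mulrC.
  have e2e' : cong (e2 * e') e'.
    apply: (@cong_trans ((e + e') * e')); first exact: congMr.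
    by rewrite mulrDl -[X in cong _ X]add0r; apply: congD.
  split=> //.
    apply: (@cong_trans (e2 * (e + e'))); first exact: congMl.
    rewrite mulrDr; apply: cong_trans (congD e2e e2e') _; exact: cong_sym.
  (* Strict growth: modulo [m], [e] and [e'] are multiples of [e2], but [e'] is not a multiple of
     [e], being a nonzero idempotent orthogonal to [e]. *)
  apply: leq_ltn_trans kmu _; apply: proper_card; apply/properP; split.
    apply/fintype.subsetP => c; rewrite !inE => -[t Ot <-].
    exists (e * t); first exact: OKM.
    apply: (rP _ _ _ _).2; first by apply: OKM => //; apply: OKM.
      exact: OKM.
    by rewrite mulrA; apply: congMr.
  exists (r e').
    rewrite !inE; exists e' => //; apply: (rP _ _ _ _).2 => //; exact: OKM.
  apply/negP; rewrite !inE => -[t Ot rete']; apply: e'0.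
  have ete' : cong (e * t) e' by apply: (rP _ _ _ _).1 rete' => //; exact: OKM.
  apply: cong_trans (cong_sym ee') _.
  apply: (@cong_trans (e' * (e * t))).
    by apply: congMl => //; apply: cong_sym.
  by rewrite mulrA -[X in cong _ X](mul0r t) [e' * e]mulrC; apply: congMr.
have [//|[x [y [_ _ _ lt_mu]]]] := H #|F|.+1.
by have := leq_trans lt_mu (max_card _); rewrite ltnn.
Qed.
End Congruence.

(** * Ideal classes killed by [l] and their generators *)

Section TorsionClasses.
Variable K : fieldExtType rat.
Local Notation OK := (ring_of_integers K).
Implicit Types (x y : K) (I : set K).

(** Otherwise [-1/m] would be an algebraic integer, hence an integer. *)
Lemma cong01 m : (1 < m)%N -> ~ cong m (0 : K) 1.
Proof.
move=> m1 [t Ot]; rewrite sub0r => tE.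
have m0 : (m%:R : rat) != 0 by rewrite pnatr_eq0 -lt0n ltnW.
have tq : t = (- m%:R^-1)%:A.
  apply: (mulIf (_ : (m%:R : K) != 0)).
    by rewrite -(rmorph_nat (in_alg K)) fmorph_eq0.
  by rewrite !mulr_natr -tE scalerMnl -mulr_natr mulNr mulVf// scaleN1r.
move: Ot; rewrite tq => /OK_rat_int; rewrite rpredN => /intrP[z zE].
have : (z * m)%:~R = 1 :> rat by rewrite intrM -zE -pmulrn mulVf.
move/(intr_inj (x2 := 1))/(congr1 absz); rewrite abszM /= => /eqP.
by rewrite muln_eq1 => /andP[_ /eqP m1']; move: m1; rewrite m1'.
Qed.

Definition ideal_pow I m : set K := iter m (ideal_mul I) OK.

Lemma ideal_scale1 I : ideal_scale 1 I = I.
Proof.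
apply/seteqP; split=> x; first by case=> y Iy <-; rewrite mul1r.
by move=> Ix; exists x; rewrite ?mul1r.
Qed.

Lemma ideal_scaleM a b I : ideal_scale a (ideal_scale b I) = ideal_scale (a * b) I.
Proof.
apply/seteqP; split=> x.
  by case=> _ [y Iy <-] <-; exists y; rewrite ?mulrA.
by case=> y Iy <-; exists (b * y); [exists y | rewrite mulrA].
Qed.

Lemma ideal_class_scale a I : a != 0 ->
  ideal_class (ideal_scale a I) = ideal_class I.
Proof.
move=> a0; apply/seteqP; split=> L [b b0 <-].
  by exists (b * a); rewrite /= ?mulf_neq0// ideal_scaleM.
exists (b / a); first by rewrite /= mulf_neq0 ?invr_eq0.
by rewrite ideal_scaleM divfK.
Qed.

Lemma class_mul_pow m I : class_mul m (ideal_class I) = ideal_class (ideal_pow I m).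
Proof.
elim: m => [//|m IHm]; rewrite /class_mul iterS -/(class_mul _ _) IHm.
exact: class_addE.
Qed.

Lemma ideal_mul_mem I J x y : I x -> J y -> ideal_mul I J (x * y).
Proof.
move=> Ix Jy; exists [:: (x, y)]; last by rewrite big_seq1.
by move=> p; rewrite inE => /eqP ->.
Qed.

Definition ideal_inv I : set K := [set y | forall x, I x -> OK (x * y)].

Definition torsion_generator l I a :=
  [/\ frac_ideal K I, a != 0 & ideal_pow I l = ideal_scale a OK].

Lemma class_torsionP l c : class_torsion K l c ->
  exists I a, c = ideal_class I /\ torsion_generator l I a.
Proof.
move=> [[I FI <-]]; rewrite class_mul_pow => cE.
have : ideal_class (ideal_pow I l) (ideal_pow I l).
  by exists 1; [rewrite /= oner_eq0 | rewrite ideal_scale1].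
by rewrite cE => -[a a0 aE]; exists I, a.
Qed.

Section Generator.
Variables (l : nat) (I : set K) (a : K).
Hypothesis l_gt0 : (0 < l)%N.
Hypothesis Ia : torsion_generator l I a.

Lemma torsion_generator_root x : I x -> OK (x ^+ l / a).
Proof.
have [_ a0 powE] := Ia; move=> Ix.
have : ideal_pow I l (x ^+ l).
  elim: {powE}l => [|m IHm]; first exact: OK1.
  by rewrite exprS; apply: ideal_mul_mem.
by rewrite powE => -[t Ot <-]; rewrite mulrAC mulfV// mul1r.
Qed.

Lemma torsion_generator_inv y : ideal_inv I y -> OK (a * y ^+ l).
Proof.
have [_ a0 powE] := Ia; move=> Jy.
have H m u : ideal_pow I m u -> OK (u * y ^+ m).
  elim: m u => [|m IHm] u; first by rewrite mulr1.
  case=> s Is ->; rewrite mulr_suml big_seq; apply: OK_sum => p /Is[Ip pp].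
  rewrite exprS mulrACA; apply: OKM; [exact: Jy | exact: IHm].
by apply: H; rewrite powE; exists 1; [exact: OK1 | rewrite mulr1].
Qed.

(** [a] is a sum of products of elements of [I] and of its power of exponent [l - 1]; dividing the
    second factors by [a] puts them in the inverse ideal. *)
Lemma torsion_generator_invertible : exists2 s : seq (K * K),
  forall p, p \in s -> I p.1 /\ ideal_inv I p.2 & \sum_(p <- s) p.1 * p.2 = 1.
Proof.
have [_ a0] := Ia; case: l l_gt0 => // m _ powE.
have [s Is aE] : ideal_pow I m.+1 a.
  by rewrite powE; exists 1; [exact: OK1 | rewrite mulr1].
exists [seq (p.1, p.2 / a) | p <- s].
  move=> _ /mapP[p /Is[Ip pp] ->]; split=> // x Ix /=.
  have : ideal_pow I m.+1 (x * p.2) by exact: ideal_mul_mem.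
  by rewrite powE => -[t Ot]; rewrite mulrA => <-; rewrite mulrAC mulfV// mul1r.
rewrite big_map /=; under eq_bigr do rewrite mulrA.
by rewrite -mulr_suml -aE mulfV.
Qed.

(** With [x] in [I], [y] in its inverse and [x * y] congruent to 1, the integers [b = a * y ^+ l]
    and [b' = x ^+ l / a] have product [(x * y) ^+ l]. *)
Lemma torsion_generator_coprime m : (1 < m)%N -> exists y b b' : K,
  [/\ y != 0, b = a * y ^+ l, OK b, OK b' & cong m (b * b') 1].
Proof.
move=> m1; have m0 : (0 < m)%N by exact: ltnW.
have [[[u Iu _] IB IM _] a0 _] := Ia.
have I0 : I 0 by rewrite -(subrr u); apply: IB.
have IN x : I x -> I (- x) by move=> Ix; rewrite -sub0r; apply: IB.
have ID x y : I x -> I y -> I (x + y).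
  by move=> Ix Iy; rewrite -[y]opprK; apply/IB/IN.
have [s Is s1] := torsion_generator_invertible.
have [x [y [Ix Jy xy]]] : exists x y, [/\ I x, ideal_inv I y & cong m (x * y) 1].
  apply: (coprime_pair_mod m0 I0 _ ID _ IM _ _ Is s1) => //.
  - by move=> x Ix; rewrite mulr0; apply: OK0.
  - by move=> x y Jx Jy z Iz; rewrite mulrDr; apply: OKD; [apply: Jx|apply: Jy].
  - by move=> b x Ob Jx z Iz; rewrite mulrCA; apply: OKM => //; apply: Jx.
  - by move=> x y Ix; apply.
have xyl : cong m ((x * y) ^+ l) 1.
  have Oxy : OK (x * y) by exact: Jy.
  elim: (l) => [|k IHk]; first exact: congxx.
  rewrite exprS -[X in cong _ _ X]mul1r; apply: congM => //; exact: OK1.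
exists y, (a * y ^+ l), (x ^+ l / a); split=> //.
- apply/eqP => y0; apply: (cong01 m1); move: xyl.
  by rewrite y0 mulr0 expr0n gtn_eqF.
- exact: torsion_generator_inv.
- exact: torsion_generator_root.
- by rewrite mulrC mulrA divfK// -exprMn.
Qed.

End Generator.

(** Multiply [x / d] by 1, written as a sum of [p.1 * p.2] with [p.1] in [I'] and [p.2] in its
    inverse. Each [x / d * p.2] is integral, since its [l]-th power is the product of the integers
    [x ^+ l / a] and [a' * p.2 ^+ l]. *)
Lemma torsion_generator_inj_sub l I I' a a' d : (0 < l)%N ->
  torsion_generator l I a -> torsion_generator l I' a' ->
  d != 0 -> a = d ^+ l * a' -> forall x, I x -> I' (x / d).
Proof.
move=> l0 Ia Ia' d0 aE x Ix; have [[[u Iu _] IB IM _] a0 _] := Ia'.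
have I0 : I' 0 by rewrite -(subrr u); apply: IB.
have IN y : I' y -> I' (- y) by move=> Iy; rewrite -sub0r; apply: IB.
have ID y z : I' y -> I' z -> I' (y + z).
  by move=> Iy Iz; rewrite -[z]opprK; apply/IB/IN.
have [s Is s1] := torsion_generator_invertible l0 Ia'.
rewrite -[x / d]mulr1 -s1 mulr_sumr big_seq.
apply: (big_ind I' I0 ID) => p /Is[Ip Jp].
rewrite mulrCA mulrC; apply: IM => //; apply: (OK_root_exp l0).
have := OKM (torsion_generator_root Ia Ix) (torsion_generator_inv Ia' Jp).
rewrite aE !exprMn exprVn; congr (OK _); field.
by rewrite a0 expf_neq0.
Qed.

Lemma torsion_generator_inj l I I' a a' d : (0 < l)%N ->
  torsion_generator l I a -> torsion_generator l I' a' ->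
  a = d ^+ l * a' -> ideal_class I = ideal_class I'.
Proof.
move=> l0 Ia Ia' aE; have [_ a0 _] := Ia; have [_ a'0 _] := Ia'.
have d0 : d != 0.
  by apply: contra_neq a0 => d0; rewrite aE d0 expr0n gtn_eqF ?mul0r.
rewrite -(ideal_class_scale I' d0); congr ideal_class.
apply/seteqP; split=> x.
  move=> Ix; exists (x / d); last by rewrite mulrC divfK.
  exact: (torsion_generator_inj_sub l0 Ia Ia' d0 aE).
case=> y Iy <-.
have dV0 : d^-1 != 0 by rewrite invr_eq0.
have aE' : a' = d^-1 ^+ l * a by rewrite aE exprVn mulKf// expf_neq0.
have := torsion_generator_inj_sub l0 Ia' Ia dV0 aE' Iy.
by rewrite invrK mulrC.
Qed.

End TorsionClasses.

(** * Trace forms of radical extensions *)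

Lemma sum_mxtens (V : nmodType) (p q : nat) (F : 'I_(p * q) -> V) :
  \sum_i F i = \sum_(t < p) \sum_(s < q) F (mxtens_index (t, s)).
Proof.
rewrite pair_big /= (reindex (@mxtens_index p q)); last first.
  by exists (@mxtens_unindex p q) => i _; rewrite ?mxtens_indexK ?mxtens_unindexK.
by apply: eq_bigr => -[].
Qed.

Section RadicalExtension.
Variables (K L : fieldExtType rat) (j : {rmorphism K -> L}) (l : nat).
Local Notation n := (\dim {:K}).
Hypothesis l_prime : prime l.

Lemma rmorph_numZ a x : j (a *: x) = a *: j x.
Proof. exact: fmorph_numZ. Qed.

Lemma image_subfield : exists E : {subfield L},
  \dim E = n /\ forall x, x \in E <-> exists k, x = j k.
Proof.
pose jM := GRing.isScalable.Build rat K L *:%R j rmorph_numZ.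
pose jL : {lrmorphism K -> L} := HB.pack (j : K -> L) j jM.
pose f : 'AHom(K, L) := linfun jL.
exists [aspace of (f @: {:K})%VS]; split=> [|x].
  by rewrite /= limg_dim_eq// (eqP (AHom_lker0 f)) capv0.
split=> [/memv_imgP[k _ ->]|[k ->]]; first by exists k; rewrite lfunE.
by apply/memv_imgP; exists k; rewrite ?memvf ?lfunE.
Qed.

Hypothesis dim_L : \dim {:L} = (l * n)%N.
Variables (g : L) (a : K).
Hypotheses (gl : g ^+ l = j a) (gK : forall k, g <> j k).

(** The degree of [g] over the image of [K] divides the prime [l] and is not 1, so the powers of [g]
    below [l] span [L]. *)
Lemma radical_span x : exists k : 'I_l -> K, x = \sum_(t < l) g ^+ t * j (k t).
Proof.
have [E [dimE memE]] := image_subfield.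
have gE : g \notin E by apply/negP => /memE[k]; exact: gK.
have degl : adjoin_degree E g = l.
  have : (adjoin_degree E g * n %| l * n)%N.
    by rewrite -dim_L -dimE -dim_Fadjoin; apply/field_dimS/subvf.
  rewrite dvdn_pmul2r ?dim_field_gt0// => /(primeP l_prime).2/orP[|/eqP//].
  by rewrite adjoin_deg_eq1 (negPf gE).
have xE : x \in <<E; g>>%VS.
  suff -> : <<E; g>>%VS = fullv by rewrite memvf.
  by apply/eqP; rewrite eqEdim subvf dim_Fadjoin degl dimE dim_L /=.
have [p pE [pl xp]] : exists2 p, p \is a polyOver E & (size p <= l)%N /\ p.[g] = x.
  exists (Fadjoin_poly E g x); first exact: Fadjoin_polyOver.
  by rewrite (leq_trans (size_Fadjoin_poly _ _ _)) ?degl// Fadjoin_poly_eq.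
have /choice[k kE] (t : 'I_l) : exists k, p`_t = j k.
  by apply/memE; move/polyOverP: pE; apply.
exists k; rewrite -xp (horner_coef_wide _ pl); apply: eq_bigr => t _.
by rewrite mulrC kE.
Qed.

Section Basis.
Variable w : n.-tuple K.
Hypothesis wK : basis_of {:K} w.

(** Pairs formed by a power of [g] and a vector of [w] are coded as indices below [l * n], which
    cuts Gram matrices into square blocks of size [n]. *)
Definition radical_basis : (l * n).-tuple L :=
  [tuple g ^+ (mxtens_unindex i).1 * j w`_(mxtens_unindex i).2 | i < l * n].
Local Notation rb := radical_basis.

Lemma radical_basis_nth (t : 'I_l) (s : 'I_n) :
  rb`_(mxtens_index (t, s)) = g ^+ t * j w`_s.
Proof. by rewrite -tnth_nth tnth_mktuple mxtens_indexK. Qed.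

Lemma radical_sum (k : 'I_l -> K) : \sum_(t < l) g ^+ t * j (k t) =
  \sum_(i < l * n) coord w (mxtens_unindex i).2 (k (mxtens_unindex i).1) *: rb`_i.
Proof.
rewrite sum_mxtens; apply: eq_bigr => t _.
rewrite {1}(coord_basis wK (memvf (k t))) rmorph_sum mulr_sumr.
apply: eq_bigr => s _; rewrite radical_basis_nth mxtens_indexK /=.
by rewrite rmorph_numZ scalerAr.
Qed.

Lemma radical_basisP : basis_of {:L} rb.
Proof.
rewrite basisEdim size_tuple dim_L leqnn andbT; apply/subvP => x _.
have [k ->] := radical_span x; rewrite radical_sum.
apply: memv_suml => i _; apply/memvZ/memv_span.
by rewrite -tnth_nth mem_tnth.
Qed.

Lemma coord_radical u b t s : (u < l)%N ->
  coord rb (mxtens_index (t, s)) (g ^+ u * j b) = (u == t)%:R * coord w s b.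
Proof.
move=> ul; pose k (r : 'I_l) := if r == Ordinal ul then b else 0.
have -> : g ^+ u * j b = \sum_(r < l) g ^+ r * j (k r).
  rewrite (bigD1 (Ordinal ul))//= /k eqxx big1 ?addr0// => r /negPf ->.
  by rewrite rmorph0 mulr0.
rewrite radical_sum coord_sum_free ?(basis_free radical_basisP)//.
rewrite mxtens_indexK /= /k -(inj_eq val_inj) /= eq_sym.
by case: eqP; rewrite ?mul1r// linear0 mul0r.
Qed.

(** For [0 < i < l], multiplication by [g ^+ i] moves each block of the basis to another one, so its
    diagonal is zero; for [i = 0] each of the [l] blocks contributes the trace of [b] over [K]. *)
Lemma field_trace_radical i b : (i < l)%N ->
  field_trace (j b * g ^+ i) = (i == 0%N)%:R * (l%:R * field_trace b).
Proof.
move=> il; rewrite (trace_coord _ radical_basisP) sum_mxtens.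
rewrite (trace_coord _ wK) (eq_bigr (fun=> (i == 0%N)%:R *
    \sum_(s < n) coord w s (b * w`_s))).
  by rewrite sumr_const card_ord [l%:R * _]mulr_natl mulrnAr.
move=> t _; rewrite mulr_sumr; apply: eq_bigr => s _; rewrite radical_basis_nth.
have [tl|lt] := ltnP (t + i) l.
  have -> : j b * g ^+ i * (g ^+ t * j w`_s) = g ^+ (t + i) * j (b * w`_s).
    by rewrite rmorphM exprD; ring.
  by rewrite coord_radical//; congr (_%:R * _); lia.
have i0 : (0 < i)%N by have := ltn_ord t; lia.
have til : (t + i - l < t)%N by lia.
have -> : j b * g ^+ i * (g ^+ t * j w`_s) =
    g ^+ (t + i - l) * j (a * (b * w`_s)).
  by rewrite !rmorphM -gl [RHS]mulrA -exprD subnK// exprD; ring.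
rewrite coord_radical ?(ltn_trans til)//.
by rewrite (ltn_eqF til) (gtn_eqF i0) !mul0r.
Qed.

(** The total exponent of [g] is [l + t - t'], and the trace vanishes unless it is a multiple of
    [l]. Only [t = t'] survives, where [g ^+ l] becomes [a]: the Gram matrix is block diagonal with
    equal blocks. *)
Lemma radical_trace_form (t t' : 'I_l) (s s' : 'I_n) :
  field_trace (g ^+ t * j w`_s * (g ^+ (l - t') * j w`_s')) =
  (t == t')%:R * (l%:R * field_trace (a * (w`_s * w`_s'))).
Proof.
have [tt'|t't|/val_inj ->] := ltngtP t t'.
- have e : (t + (l - t') < l)%N by have := ltn_ord t'; lia.
  have -> : g ^+ t * j w`_s * (g ^+ (l - t') * j w`_s') =
      j (w`_s * w`_s') * g ^+ (t + (l - t')).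
    by rewrite rmorphM exprD; ring.
  rewrite field_trace_radical// -(inj_eq val_inj) /= (ltn_eqF tt').
  by rewrite gtn_eqF ?mul0r//; have := ltn_ord t'; lia.
- have e : (t - t' < l)%N by have := ltn_ord t; lia.
  have -> : g ^+ t * j w`_s * (g ^+ (l - t') * j w`_s') =
      j (a * (w`_s * w`_s')) * g ^+ (t - t').
    rewrite !rmorphM -gl.
    transitivity (j w`_s * j w`_s' * g ^+ (t + (l - t'))).
      by rewrite exprD; ring.
    have -> : (t + (l - t') = l + (t - t'))%N by have := ltn_ord t'; lia.
    by rewrite exprD; ring.
  rewrite field_trace_radical// -(inj_eq val_inj) /= (gtn_eqF t't).
  by rewrite gtn_eqF ?mul0r//; lia.
have <- : field_trace (j (a * (w`_s * w`_s')) * g ^+ 0) =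
    field_trace (g ^+ t' * j w`_s * (g ^+ (l - t') * j w`_s')).
  congr field_trace; rewrite expr0 mulr1 !rmorphM -gl.
  rewrite -{1}(subnKC (ltnW (ltn_ord t'))).
  by rewrite exprD; ring.
by rewrite field_trace_radical ?prime_gt0// !eqxx !mul1r.
Qed.

End Basis.
End RadicalExtension.

(** * Block determinants and integer matrices modulo an integer *)

Lemma det_block_diagonal (R : comNzRingType) k n (B : 'M[R]_n) (G : 'M[R]_(k * n)) :
  (forall t t' s s', G (mxtens_index (t, s)) (mxtens_index (t', s')) =
    (t == t')%:R * B s s') -> \det G = \det B ^+ k.
Proof.
elim: k G => [|k IHk] G GE; first by rewrite det_mx00.
(* [k.+1 * n] computes to [n + k * n], which exposes the first block. *)
pose G' : 'M[R]_(n + k * n) := G.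
have idl (s : 'I_n) : lshift (k * n) s = mxtens_index (ord0 : 'I_k.+1, s).
  exact: val_inj.
have idr t (s : 'I_n) :
    rshift n (mxtens_index (t, s)) = mxtens_index (lift ord0 t : 'I_k.+1, s).
  by apply: val_inj; rewrite /= /bump /= mulnDl mul1n addnA.
have idrP (q : 'I_(k * n)) : exists t s, q = mxtens_index (t, s).
  by case: (mxtens_indexP q) => t s; exists t, s.
have -> : \det G = \det G' by [].
rewrite -[G']submxK.
have -> : ulsubmx G' = B.
  by apply/matrixP => s s'; rewrite !mxE !idl [LHS]GE eqxx mul1r.
have -> : ursubmx G' = 0.
  apply/matrixP => s q; have [t' [s' ->]] := idrP q.
  by rewrite !mxE idl idr [LHS]GE mul0r.
rewrite det_lblock exprS; congr (_ * _); apply: IHk => t t' s s'.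
by rewrite !mxE !idr [LHS]GE (inj_eq lift_inj).
Qed.

Lemma eqz_mod_det n (m : int) (A B : 'M[int]_n) :
  (forall i j, m %| A i j - B i j)%Z -> (m %| \det A - \det B)%Z.
Proof.
move=> AB; rewrite -sumrB; apply: rpred_sum => s _; rewrite -mulrBr.
apply: dvdz_mull; apply: (big_ind2 (fun x y => (m %| x - y)%Z))
  => [|x1 x2 y1 y2 d1 d2|i _].
- by rewrite subrr dvdz0.
- rewrite (_ : x1 * y1 - x2 * y2 = (x1 - x2) * y1 + x2 * (y1 - y2)); last by ring.
  by apply: rpredD; [apply: dvdz_mulr | apply: dvdz_mull].
- exact: AB.
Qed.

(** Modulo [p] the matrix is nilpotent, so its characteristic polynomial is a power of ['X] and its
    trace is zero. *)
Lemma dvdz_trace_nilpotent p n (A B : 'M[int]_n) N : prime p ->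
  iter N (mulmx A) 1%:M = p%:Z *: B -> (p %| \tr A)%Z.
Proof.
move=> p_pr; case: n A B => [|n] A B AN; first by rewrite /mxtrace big_ord0 dvdz0.
have pF : p \in [pchar 'F_p] by exact: pchar_Fp.
pose f := intmul 1 : {rmorphism int -> 'F_p}.
rewrite (dvdz_pcharf pF) -[_%:~R]/(f _) -trace_map_mx; set A' := map_mx _ _.
have A'N : A' ^+ N = 0.
  have -> : A' ^+ N = map_mx f (iter N (mulmx A) 1%:M).
    elim: (N) => [|k IHk]; first by rewrite expr0 /= map_mx1.
    by rewrite exprS /= map_mxM IHk.
  rewrite AN map_mxZ /= -[f _]/(p%:R) (pcharf0 pF); exact: scale0r.
have dvdX : char_poly A' %| 'X^(n.+1 * N).
  pose X : 'M[{poly 'F_p}]_n.+1 := 'X%:M.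
  pose Y : 'M[{poly 'F_p}]_n.+1 := map_mx polyC A'.
  have XY : GRing.comm X Y by apply/esym/scalar_mxC.
  have YN : Y ^+ N = 0 by rewrite /Y -rmorphXn /= A'N rmorph0.
  have XN : X ^+ N = ('X^N)%:M by rewrite /X -rmorphXn.
  (* Since [Y ^+ N = 0], [X - Y] divides the scalar matrix [X ^+ N]; determinants turn this into a
     divisibility for the characteristic polynomial. *)
  have /(congr1 determinant) := subrXX_comm N XY.
  rewrite YN subr0 XN det_scalar -exprM -mulmxE det_mulmx mulnC => ->.
  exact: dvdp_mulIl.
have : char_poly A' %| ('X - 0%:P) ^+ (n.+1 * N) by rewrite subr0.
move=> /dvdp_exp_XsubCP[k _]; rewrite subr0 eqp_monic ?char_poly_monic ?monicXn//.
move=> /eqP cE; have := char_poly_trace A' (ltn0Sn n).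
have := size_char_poly A'; rewrite cE size_polyXn => -[->].
by rewrite coefXn /= ltn_eqF// => /esym/eqP; rewrite oppr_eq0.
Qed.

(** * Discriminants of radical extensions *)

Section Discriminant.
Variables (K L : fieldExtType rat) (j : {rmorphism K -> L}) (l : nat).
Local Notation n := (\dim {:K}).
Hypothesis l_prime : prime l.

Lemma rmorph_OK x : ring_of_integers K x -> ring_of_integers L (j x).
Proof.
move=> [p p1 px]; exists p => //.
have := rmorph_root j px; rewrite -map_poly_comp.
by rewrite (eq_map_poly (g := intr))// => c; apply: rmorph_int.
Qed.

Lemma rmorph_cong m x y : cong m x y -> cong m (j x) (j y).
Proof.
move=> [t Ot tE]; exists (j t); first exact: rmorph_OK.
by rewrite -rmorphB tE rmorphMn.
Qed.

Variables (g : L) (b b' : K).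
Hypotheses (Ob : ring_of_integers K b) (Ob' : ring_of_integers K b').
Hypothesis gl : g ^+ l = j (l%:R * b).

Lemma radical_integral : ring_of_integers L g.
Proof.
apply: (OK_root_exp (prime_gt0 l_prime)); rewrite gl.
by apply/rmorph_OK/OKM => //; apply: (OK_int K l).
Qed.

(** The determinant is the norm of [b]. Norms are multiplicative and respect congruences, so those
    of [b] and [b'] are inverse to each other modulo [m]. *)
Lemma det_int_mul_mx_coprime (w : n.-tuple K) m : integral_basis w ->
  cong m (b * b') 1 -> coprimez m (\det (int_mul_mx w b)).
Proof.
move=> wB [t Ot tE].
have [q qE] : exists q,
    \det (int_mul_mx w b) * \det (int_mul_mx w b') - 1 = q * m%:Z.
  apply/dvdzP; rewrite -det_mulmx -int_mul_mxM// -(det1 _ n).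
  apply: eqz_mod_det => s s'.
  have -> : b * b' = 1 + t * m%:~R by rewrite mulrzr -pmulrn -tE addrC subrK.
  have Om : ring_of_integers K m%:~R by apply: OK_int.
  rewrite int_mul_mxD ?int_mul_mxM//; [|exact: OK1|exact: OKM].
  rewrite (int_mul_mx_int wB 1) int_mul_mx_int// mul_mx_scalar.
  by rewrite mxE addrAC subrr add0r mxE dvdz_mulr.
apply/coprimezP; exists (- q, \det (int_mul_mx w b')) => /=.
by rewrite mulNr -qE; ring.
Qed.

(** The Gram determinant of the integers [g ^+ t * j w_s] against [g ^+ (l - t) * j w_s] has
    absolute value [(l ^ (2 n) D_K |N(b)|) ^ l]. It is a multiple of [D_L], and the norm [N(b)] is
    prime to [D_L], so it cancels. *)
Lemma disc_radical_dvd : \dim {:L} = (l * n)%N -> (forall k, g <> j k) ->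
  cong (abs_disc L) (b * b') 1 ->
  (abs_disc L %| (l ^ (2 * n) * abs_disc K) ^ l)%N.
Proof.
move=> dimL gK [t Ot tE].
have [w wB wD] := disc_spec K; have [wK _] := wB.
have Ow (s : 'I_n) : ring_of_integers K w`_s.
  by rewrite -tnth_nth; apply: integral_basis_OK.
pose u (q : 'I_(l * n)) : L :=
  g ^+ (mxtens_unindex q).1 * j w`_(mxtens_unindex q).2.
pose v (q : 'I_(l * n)) : L :=
  g ^+ (l - (mxtens_unindex q).1) * j w`_(mxtens_unindex q).2.
have Og := radical_integral.
have [k] := disc_dvd_trace_form dimL (u := u) (v := v)
  (fun q => OKM (OKX _ Og) (rmorph_OK (Ow _)))
  (fun q => OKM (OKX _ Og) (rmorph_OK (Ow _))).
pose B := \matrix_(s < n, s' < n)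
  (l%:R * field_trace (l%:R * b * (w`_s * w`_s')) : rat).
rewrite (@det_block_diagonal _ _ _ B); last first.
  move=> t1 t2 s1 s2; rewrite !mxE /u /v !mxtens_indexK /=.
  exact: radical_trace_form.
(* One factor [l] comes from the trace of [L] over [K], the other from the radicand [l * b]. *)
have -> : B = l%:R *: (l%:R *: mul_mx w b *m trace_form (tnth w) (tnth w)).
  apply/matrixP => s s'; rewrite !mxE; congr (_ * _).
  have -> : l%:R * b * (w`_s * w`_s') = (l%:R : rat) *: (b * w`_s * w`_s').
    by rewrite scaler_nat -[RHS]mulr_natl !mulrA.
  rewrite linearZ /= (mul_mxE wK b).
  rewrite mulr_suml linear_sum mulr_sumr; apply: eq_bigr => r _.
  by rewrite -scalerAl linearZ /= !mxE !(tnth_nth 0) mulrA.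
rewrite detZ det_mulmx detZ -int_mul_mxE// det_map_mx -wD.
set N := \det (int_mul_mx w b).
rewrite -!(rmorph_nat (intmul 1 : {rmorphism int -> rat})) -!rmorphXn -!rmorphM.
rewrite -rmorphXn => /intr_inj /(congr1 absz).
rewrite !(abszX, abszM) /= natz /= => kE.
have cop : coprime (abs_disc L) (`|N| ^ l)%N.
  apply: coprimeXr; have := det_int_mul_mx_coprime wB (ex_intro2 _ _ t Ot tE).
  by rewrite coprimezE.
rewrite -(Gauss_dvdl _ cop) -expnMn.
suff -> : ((l ^ (2 * n) * abs_disc K * `|N|) ^ l = `|k| * abs_disc L)%N.
  by rewrite dvdn_mull.
rewrite /abs_disc -kE; congr (_ ^ _)%N.
by rewrite mul2n -addnn expnD !mulnA mulnAC.
Qed.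

(* With unimodular trace form, [Tr(g z)] being divisible by [l] for all integers
   [z] makes [g / l] integral, too divisible for [g ^+ l = j (l%:R * b)]. *)
Lemma disc_radical_neq1 : cong l (b * b') 1 -> abs_disc L <> 1%N.
Proof.
move=> bb' D1; have Og := radical_integral.
have l0 : (l%:R : L) != 0.
  by rewrite -(rmorph_nat (in_alg L)) fmorph_eq0 pnatr_eq0 -lt0n prime_gt0.
have lq0 : (l%:R : rat) != 0 by rewrite pnatr_eq0 -lt0n prime_gt0.
have Ogl : ring_of_integers L (g / l%:R).
  apply: OK_unimodular => // z Oz.
  have [w wB _] := disc_spec L.
  (* [(g * z) ^+ l] is [l] times the integer [y], so multiplication by [g * z] is nilpotent modulo
     [l]. *)
  have /dvdzP[q qE] : (l %| \tr (int_mul_mx w (g * z)))%Z.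
    pose y := j b * z ^+ l.
    have Oy : ring_of_integers L y by apply: OKM; [exact: rmorph_OK|exact: OKX].
    apply: (@dvdz_trace_nilpotent l _ _ (int_mul_mx w y) l) => //.
    have Ogz : ring_of_integers L (g * z) by exact: OKM.
    transitivity (int_mul_mx w ((g * z) ^+ l)).
      elim: (l) => [|k IHk] /=; first by rewrite expr0 (int_mul_mx_int wB 1).
      by rewrite IHk exprS (int_mul_mxM wB Ogz (OKX k Ogz)).
    have -> : (g * z) ^+ l = l%:~R * y.
      by rewrite exprMn gl rmorphM rmorph_nat /y mulrA -pmulrn.
    rewrite int_mul_mxM//; last exact: OK_int.
    by rewrite int_mul_mx_int// mul_scalar_mx.
  have -> : g / l%:R * z = (l%:R^-1 : rat) *: (g * z).
    rewrite -mulrA [_^-1 * z]mulrC mulrA mulrC -mulr_algl; congr (_ * _).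
    by rewrite -(rmorph_nat (in_alg L)) -fmorphV.
  rewrite linearZ /= (field_trace_int_mul_mx wB); last exact: OKM.
  by rewrite qE intrM -pmulrn mulrC mulfK// intr_int.
(* Now [j b], equal to [l ^ (l - 1)] times [(g / l) ^+ l], is divisible by [l]; hence 1, congruent
   to [j (b * b')], would be congruent to 0. *)
apply: (cong01 (K := L) (prime_gt1 l_prime)).
rewrite -(rmorph1 j); apply: cong_trans (rmorph_cong bb').
apply: cong_sym; exists (l%:R ^+ l.-2 * (g / l%:R) ^+ l * j b').
  apply: OKM; last exact: rmorph_OK.
  by apply: OKM; [apply/OKX/(OK_int L l)|apply: OKX].
have jb : j b = l%:R ^+ l.-1 * (g / l%:R) ^+ l.
  apply: (mulfI l0); rewrite mulrA -exprS prednK ?prime_gt0//.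
  have gll : l%:R * (g / l%:R) = g by rewrite mulrC divfK.
  by rewrite -exprMn gll gl rmorphM rmorph_nat.
have l2 : l.-1 = l.-2.+1 by move: (prime_gt1 l_prime); case: (l) => [|[]].
by rewrite subr0 rmorphM jb -[RHS]mulr_natl !mulrA -exprS l2.
Qed.

End Discriminant.

(** * Primitive elements and embeddings into [algC] *)

Section PrimitiveElement.
Variable K : fieldExtType rat.

Lemma primitive_element : exists z : K,
  forall x, exists p : {poly rat}, x = (map_poly (in_alg K) p).[z].
Proof.
exists (separable_generator 1%AS {:K}) => x; apply/Fadjoin1_polyP.
have sepK : separable 1%AS {:K}.
  apply/separableP => y _; apply: pcharf0_separable => p.
  by rewrite (pchar_lalg K); apply: pchar_num.
by have /subvP := sub_adjoin_separable_generator sepK; apply; apply: memvf.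
Qed.

(** A primitive element [z] is sent to a root [r] of its minimal polynomial. The polynomial [q x]
    representing [x] is merely chosen, so [wd] checks that its value at [r] depends on [x] alone. *)
Lemma embedding_exists : inhabited {rmorphism K -> algC}.
Proof.
have [z zK] := primitive_element; have /choice[q qE] := zK.
have /polyOver1P[p pE] := minPolyOver 1%AS z.
have [r pr] : exists r, root (map_poly (@ratr algC) p) r.
  apply: closed_rootP; rewrite size_map_poly -(size_map_poly (in_alg K)) -pE.
  by rewrite size_minPoly.
have wd (f h : {poly rat}) :
    (map_poly (in_alg K) f).[z] = (map_poly (in_alg K) h).[z] ->
    (map_poly (@ratr algC) f).[r] = (map_poly (@ratr algC) h).[r].
  move=> fh; apply/eqP; rewrite -subr_eq0 -hornerN -hornerD -rmorphN -rmorphD /=.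
  have : minPoly 1%AS z %| map_poly (in_alg K) (f - h).
    apply: minPoly_dvdp; first by apply/polyOver1P; exists (f - h).
    by rewrite /root rmorphB hornerD hornerN fh subrr.
  rewrite pE dvdp_map => /dvdpP[u ->].
  by rewrite rmorphM hornerM (rootP pr) mulr0.
pose iota x := (map_poly (@ratr algC) (q x)).[r].
have iotaB : zmod_morphism iota.
  move=> x y; rewrite /iota -hornerN -hornerD -rmorphN -rmorphD /=; apply: wd.
  by rewrite -qE rmorphD rmorphN hornerD hornerN -!qE.
have iotaM : monoid_morphism iota.
  split=> [|x y]; rewrite /iota.
    by rewrite -[RHS](hornerC 1 r) -[1%:P in RHS](rmorph1 (map_poly (@ratr algC)));
      apply: wd; rewrite -qE rmorph1 hornerC.
  rewrite -hornerM -rmorphM /=; apply: wd.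
  by rewrite -qE rmorphM hornerM -!qE.
pose B := GRing.isZmodMorphism.Build K algC iota iotaB.
pose M := GRing.isMonoidMorphism.Build K algC iota iotaM.
constructor; exact: (HB.pack iota B M : {rmorphism K -> algC}).
Qed.

End PrimitiveElement.

(** * Radical fields over an embedded [K] *)

Section RadicalField.
Variables (K : fieldExtType rat) (iota : {rmorphism K -> algC}) (l : nat).
Local Notation n := (\dim {:K}).
Hypothesis l_prime : prime l.

(* The constant term [d] of the minimal polynomial of [g], of degree [k],
   satisfies [d ^ l = (-1)^(k l) a ^ k]; if [k < l], then [k] is prime to [l] and
   Bezout makes [a] an [l]-th power. *)
Lemma adjoin_radical_degree (L : fieldExtType rat) (j : {rmorphism K -> L})
    (f : {rmorphism L -> algC}) (E : {subfield L}) g a :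
  (forall x, x \in E <-> exists k, x = j k) -> g ^+ l = j a ->
  (forall k, a <> k ^+ l) -> adjoin_degree E g = l.
Proof.
move=> memE gl al; set k := adjoin_degree E g.
have l0 := prime_gt0 l_prime.
have a0 : a != 0 by apply/eqP => a0; apply: (al 0); rewrite a0 expr0n gtn_eqF.
have dvd : minPoly E g %| 'X^l - (j a)%:P.
  apply: minPoly_dvdp; last by rewrite /root !hornerE gl subrr.
  by rewrite rpredB ?rpredX ?polyOverX// polyOverC; apply/memE; exists a.
have kl : (k <= l)%N.
  have := dvdp_leq _ dvd; rewrite size_XnsubC// size_minPoly ltnS; apply.
  by rewrite monic_neq0 ?monicXnsubC.
have [d dE] : exists d, (minPoly E g)`_0 = j d.
  by apply/memE; have /polyOverP := minPolyOver E g; apply.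
(* All [k] roots in [algC] of the minimal polynomial have [l]-th power [f (j a)], and [f (j d)] is
   [(-1) ^+ k] times their product. *)
have dl : d ^+ l = ((-1) ^+ k) ^+ l * a ^+ k.
  apply: (fmorph_inj j); apply: (fmorph_inj f).
  have [rs rsE] := closed_field_poly_normal (map_poly f (minPoly E g)).
  rewrite (monicP _) ?monic_map ?monic_minPoly// scale1r in rsE.
  have rsk : size rs = k.
    apply: succn_inj; rewrite -(size_prod_XsubC _ id) -rsE size_map_poly.
    by rewrite size_minPoly.
  have rl r : r \in rs -> r ^+ l = f (j a).
    move=> rrs; have : root (map_poly f ('X^l - (j a)%:P)) r.
      apply: root_dvdp (_ : root (map_poly f (minPoly E g)) r).
        by rewrite dvdp_map.
      by rewrite rsE root_prod_XsubC.
    by rewrite /root rmorphB /= map_polyXn map_polyC !hornerE subr_eq0 => /eqP.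
  rewrite !(rmorphM, rmorphXn, rmorphN1) -dE -coef_map rsE coef0_prod_XsubC rsk.
  rewrite exprMn; congr (_ * _); rewrite -prodrXl big_seq.
  under eq_bigr => r rrs do rewrite (rl r rrs).
  by rewrite -big_seq big_const_seq count_predT rsk iter_mulr_1.
have [//|kl'] := eqVneq k l; exfalso.
have {kl'}kl : (k < l)%N by rewrite ltn_neqAle kl' kl.
have k0 : (0 < k)%N by [].
have cop : gcdn k l = 1%N.
  by apply/eqP; rewrite -/(coprime k l) coprime_sym prime_coprime// gtnNdvd.
have [u v uv _] := egcdnP l k0.
(* Here [u * k = v * l + 1], so the [l]-th power of the witness is [a ^+ (u * k) / a ^+ (v * l)],
   that is [a]; the factor [(-1) ^+ k] cancels the sign in [dl]. *)
apply: (al (((-1) ^+ k * d) ^+ u / a ^+ v)).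
rewrite exprMn exprVn -exprM mulnC exprM exprMn dl mulrA -exprMn -expr2 sqrr_sign.
rewrite expr1n mul1r -!exprM [(k * u)%N]mulnC uv cop addn1 exprS.
by rewrite mulfK// expf_neq0.
Qed.

(** [L] realises the subfield of [algC] generated by the image of a primitive element of [K] and an
    [l]-th root of [iota a]. It contains the image of [iota], which therefore factors through [f];
    the factor is [j]. *)
Lemma radical_field a : (forall k, a <> k ^+ l) ->
  exists (L : fieldExtType rat) (f : {rmorphism L -> algC})
    (j : {rmorphism K -> L}) (g : L),
    [/\ \dim {:L} = (l * n)%N, forall x, f (j x) = iota x,
        g ^+ l = j a & forall k, g <> j k].
Proof.
move=> al; have l0 := prime_gt0 l_prime; have [z zK] := primitive_element K.
pose th := l.-root (iota a); have thl : th ^+ l = iota a by apply: rootCK.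
have [L [f [s1 s1E s1L]]] := num_field_exists [:: iota z; th].
case: s1 s1E s1L => [|z1 [|g [|]]]//= [z1E gE] L_gen.
have ratE (F : fieldExtType rat) (h : {rmorphism F -> algC}) p :
    map_poly h (map_poly (in_alg F) p) = map_poly (@ratr algC) p.
  rewrite -map_poly_comp; apply: eq_map_poly => c /=.
  by rewrite alg_num_field fmorph_rat.
have /choice[j jE] x : exists y, f y = iota x.
  have [p ->] := zK x; exists (map_poly (in_alg L) p).[z1].
  by rewrite -!horner_map /= !ratE z1E.
have jB : zmod_morphism j.
  by move=> x y; apply: (fmorph_inj f); rewrite !(jE, rmorphB).
have jM : monoid_morphism j.
  split=> [|x y]; apply: (fmorph_inj f); rewrite ?jE ?rmorph1//.
  by rewrite !(jE, rmorphM).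
pose B := GRing.isZmodMorphism.Build K L j jB.
pose M := GRing.isMonoidMorphism.Build K L j jM.
pose J : {rmorphism K -> L} := HB.pack j B M.
have gl : g ^+ l = J a.
  by apply: (fmorph_inj f); rewrite /= jE rmorphXn gE.
exists L, f, J, g; split=> //; last first.
  move=> k gk; apply: (al k); apply: (fmorph_inj J).
  by rewrite rmorphXn -gk gl.
have [E [dimE memE]] := image_subfield J.
have Eg : <<E; g>>%VS = fullv.
  apply/eqP; rewrite eqEsubv subvf -L_gen; apply/Fadjoin_seqP.
  split=> [|x]; first exact: sub1v.
  rewrite !inE => /orP[]/eqP->; last exact: memv_adjoin.
  apply: (subvP (subv_adjoin _ _)); apply/memE; exists z.
  by apply: (fmorph_inj f); rewrite /= jE z1E.
by rewrite -Eg dim_Fadjoin (adjoin_radical_degree f memE gl al) dimE.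
Qed.

(** The [t r] are independent over [K]: a ratio of two distinct ones lies outside [K] and has [l]-th
    power in [K], so its multiples by [K] have trace zero. Counting dimensions gives
    [m * n <= l * n]. *)
Lemma radical_multiplicity (L : fieldExtType rat) (j : {rmorphism K -> L}) m
    (t : 'I_m -> L) (a : 'I_m -> K) : \dim {:L} = (l * n)%N ->
  (forall r, t r != 0) -> (forall r, t r ^+ l = j (a r)) ->
  (forall r s k, t r = j k * t s -> r = s) -> (m <= l)%N.
Proof.
move=> dimL t0 tl tinj; pose w := vbasis {:K}.
have wK : basis_of {:K} w := vbasisP _.
have tr0 r s k : r != s -> field_trace (j k * (t r / t s)) = 0.
  move=> rs; have := @field_trace_radical K L j l l_prime dimL (t r / t s)
    (a r / a s) _ _ w wK 1 k (prime_gt1 l_prime).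
  rewrite expr1 mul0r; apply.
    by rewrite expr_div_n !tl fmorph_div.
  move=> k' tk'; have := tinj r s k'; rewrite -tk' divfK// => /(_ erefl) /eqP.
  by rewrite (negPf rs).
pose X := [tuple j w`_(mxtens_unindex i).2 * t (mxtens_unindex i).1 | i < m * n].
suff Xfree : free X.
  have : (size X <= \dim {:L})%N.
    by rewrite -(eqP Xfree) dimvS ?subvf.
  by rewrite size_tuple dimL leq_pmul2r ?dim_field_gt0.
apply/freeP => c; rewrite sum_mxtens => cX i.
pose k r := \sum_(s < n) c (mxtens_index (r, s)) *: w`_s.
have kt : \sum_r j (k r) * t r = 0.
  rewrite -[RHS]cX; apply: eq_bigr => r _; rewrite rmorph_sum mulr_suml.
  apply: eq_bigr => s _; rewrite rmorph_numZ -scalerAl.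
  by rewrite -(tnth_nth 0 X) tnth_mktuple mxtens_indexK.
have k0 s : k s = 0.
  (* Dividing the relation by a nonzero term [j (k s) * t s] and taking traces would make the trace
     of 1 vanish. *)
  apply/eqP/contraT => ks0; have := field_trace1 L.
  have -> : (1 : L) = \sum_r j (k r / k s) * (t r / t s)
      - \sum_(r | r != s) j (k r / k s) * (t r / t s).
    by rewrite (bigD1 s)//= addrK !mulfV// rmorph1 mulr1.
  rewrite linearB /= linear_sum /= [X in _ - X]linear_sum /=.
  rewrite [X in _ - X]big1 => [|r]; last first.
    exact: tr0.
  rewrite -linear_sum /= subr0.
  rewrite (_ : \sum_r _ = (\sum_r j (k r) * t r) * (j ((k s)^-1) / t s)); last first.
    by rewrite mulr_suml; apply: eq_bigr => r _; rewrite rmorphM mulrACA.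
  rewrite kt mul0r linear0 => /esym/eqP; rewrite pnatr_eq0 => /eqP d0.
  by have := dim_field_gt0 L; rewrite d0.
case: (mxtens_indexP i) => r s.
have /freeP/(_ (fun s => c (mxtens_index (r, s)))) := basis_free wK.
by apply; exact: k0.
Qed.

End RadicalField.

(** * The divisor bound *)

Section DivisorBound.
Local Open Scope nat_scope.

Lemma size_divisors_pfactor p N : prime p -> 0 < N ->
  size (divisors N) <= (logn p N).+1 * size (divisors (N %/ p ^ logn p N)).
Proof.
move=> p_pr N0; set e := logn p N; set m := N %/ p ^ e.
have NE : N = m * p ^ e by rewrite divnK// pfactor_dvdnn.
have m0 : 0 < m by move: N0; rewrite NE muln_gt0 => /andP[].
have := @uniq_leq_size _ (divisors N)
  [seq p ^ i * d | i <- iota 0 e.+1, d <- divisors m] (divisors_uniq N).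
rewrite size_allpairs size_iota; apply=> d; rewrite -dvdn_divisors// => dN.
have d0 : 0 < d by exact: dvdn_gt0 dN.
have [d' pd' dE] := pfactor_coprime p_pr d0.
apply/allpairsP; exists (logn p d, d'); split.
- by rewrite mem_iota add0n ltnS dvdn_leq_log.
- rewrite -dvdn_divisors// -(@Gauss_dvdl d' _ (p ^ e)); last first.
    by rewrite coprime_sym coprimeXl.
  by rewrite -NE; apply: dvdn_trans dN; rewrite {1}dE dvdn_mulr.
- by rewrite mulnC.
Qed.

Definition small_primes k N := #|[pred q : 'I_(2 ^ k) | prime q && (q %| N)]|.

(** Induction splitting off a full prime power [p ^ e]: if [p >= 2 ^ k] then [(e + 1) ^ k <= p ^ e],
    and a smaller [p] costs an extra factor [k ^ k]. *)
Lemma size_divisors_small_primes k N : 0 < k -> 0 < N ->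
  size (divisors N) ^ k <= (k ^ k) ^ small_primes k N * N.
Proof.
move=> k0; elim/ltn_ind: N => N IHN N0.
have [N1|N1] := leqP N 1.
  have -> : N = 1 by apply/eqP; rewrite eqn_leq N1.
  by rewrite [size _]/= exp1n muln1 expn_gt0 expn_gt0 k0.
set p := pdiv N; have p_pr : prime p by exact: pdiv_prime.
have := size_divisors_pfactor p_pr N0.
set e := logn p N; set m := N %/ p ^ e => sizeN.
have NE : N = m * p ^ e by rewrite divnK// pfactor_dvdnn.
have e0 : 0 < e by rewrite logn_gt0 mem_primes p_pr N0 pdiv_dvd.
have m0 : 0 < m by move: N0; rewrite NE muln_gt0 => /andP[].
have pe1 : 1 < p ^ e.
  by rewrite -(exp1n e) ltn_exp2r// prime_gt1.
have mN : m < N by rewrite [X in _ < X]NE ltn_Pmulr.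
have pm : ~~ (p %| m).
  have [m' pm' NE'] := pfactor_coprime p_pr N0.
  have -> : m = m' by rewrite /m {1}NE' mulnK// expn_gt0 prime_gt0.
  by rewrite -prime_coprime.
have sub : {subset [pred q : 'I_(2 ^ k) | prime q && (q %| m)] <=
    [pred q : 'I_(2 ^ k) | prime q && (q %| N)]}.
  by move=> q; rewrite !inE => /andP[-> qm] /=; rewrite NE dvdn_mulr.
apply: (@leq_trans ((e.+1 * size (divisors m)) ^ k)).
  by rewrite leq_exp2r.
rewrite expnMn; apply: leq_trans (leq_mul (leqnn _) (IHN m mN m0)) _.
rewrite [X in _ <= _ * X]NE.
have [p2k|k2p] := ltnP p (2 ^ k).
- have lt_small : small_primes k m < small_primes k N.
    apply: proper_card; apply/properP; split; first exact/fintype.subsetP.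
    exists (Ordinal p2k); rewrite !inE /= p_pr ?pdiv_dvd//.
  apply: (@leq_trans ((k ^ k * p ^ e) * ((k ^ k) ^ small_primes k m * m))).
    apply: leq_mul => //.
    (* With [q = e %/ k], both [e < k (q + 1)] and [q + 1 <= 2 ^ q] hold; the [k]-th power of the
       bound is at most [k ^ k * 2 ^ e]. *)
    have e1 : e.+1 <= k * 2 ^ (e %/ k).
      apply: leq_trans (ltn_ceil e k0) _.
      by rewrite mulnC leq_mul2l ltn_expl ?orbT.
    apply: (@leq_trans ((k * 2 ^ (e %/ k)) ^ k)); first by rewrite leq_exp2r.
    rewrite expnMn leq_mul2l -expnM; apply/orP; right.
    apply: (@leq_trans (2 ^ e)).
      by rewrite leq_exp2l// leq_trunc_div.
    by rewrite leq_exp2r// prime_gt1.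
  rewrite mulnACA -expnS [p ^ e * m]mulnC leq_mul2r.
  by rewrite leq_pexp2l ?orbT //= expn_gt0 k0.
- have le_small : small_primes k m <= small_primes k N.
    by apply: subset_leq_card; apply/fintype.subsetP.
    apply: (@leq_trans (p ^ e * ((k ^ k) ^ small_primes k m * m))).
    apply: leq_mul => //; apply: (@leq_trans ((2 ^ e) ^ k)).
      by rewrite leq_exp2r// ltn_expl.
    by rewrite -expnM mulnC expnM leq_exp2r.
  rewrite mulnCA leq_mul//; last by rewrite mulnC.
  by rewrite leq_pexp2l// expn_gt0 k0.
Qed.

Lemma size_divisors_bound k : 0 < k ->
  exists C, forall N, 0 < N -> size (divisors N) ^ k <= C * N.
Proof.
move=> k0; exists ((k ^ k) ^ (2 ^ k)) => N N0.
apply: leq_trans (size_divisors_small_primes k0 N0) _.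
rewrite leq_mul2r leq_pexp2l ?orbT// ?expn_gt0 ?k0//.
by apply: leq_trans (max_card _) _; rewrite card_ord.
Qed.

End DivisorBound.

(** * Cardinalities and real exponents *)

Section Counting.
Variable R : realType.

(** [counting] is infinite on infinite sets, so finiteness is proved as well: an infinite set would
    have a finite subset with more than [B] elements. *)
Lemma counting_le (T : choiceType) (A : set T) (B : R) :
  (forall s : seq T, uniq s -> (forall x, x \in s -> A x) -> (size s)%:R <= B) ->
  (counting A <= B%:E)%E.
Proof.
move=> sB; have B0 : 0 <= B by exact: (sB [::]).
have fsetB (X : {fset T}) : (forall x, x \in X -> A x) -> (#|` X|)%:R <= B.
  by move=> XA; apply: sB => [|x xX]; [exact: fset_uniq | exact: XA].
have Afin : finite_set A.
  apply: contrapT => /(infinite_set_fset (Num.bound B))[X /fsetB XB leX].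
  have := archi_boundP B0; rewrite ltNge => /negP; apply.
  by apply: le_trans XB; rewrite ler_nat.
rewrite /counting asboolT// lee_fin; apply: fsetB.
by move=> x; rewrite in_fset_set// => /set_mem.
Qed.

Lemma counting_ge (T : choiceType) (A : set T) (B : R) (s : seq T) :
  (counting A <= B%:E)%E -> uniq s -> (forall x, x \in s -> A x) ->
  (size s)%:R <= B.
Proof.
rewrite /counting; case: asboolP => // Afin; rewrite lee_fin => AB us sA.
apply: le_trans AB; rewrite ler_nat; apply: uniq_leq_size => // x /sA Ax.
by rewrite in_fset_set// mem_set.
Qed.

Lemma powR_divisors_bound (u e : R) : 0 <= u -> 0 < e -> exists2 C : R, 0 <= C &
  forall N : nat, (0 < N)%N ->
    (size (divisors N))%:R * N%:R `^ (u + e) <= C * N%:R `^ (u + e + e).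
Proof.
(* This [k] satisfies [1 / k <= e], so a bound of order [N ^ (1 / k)] on the number of divisors
   suffices. *)
move=> u0 e0; pose k := (Num.bound e^-1).+1.
have ke : (k%:R : R)^-1 <= e.
  rewrite invf_ple ?posrE ?ltr0n// ltW// (@lt_trans _ _ (Num.bound e^-1)%:R)//.
    by rewrite archi_boundP// invr_ge0 ltW.
  by rewrite ltr_nat.
have [C CP] := size_divisors_bound (isT : (0 < k)%N).
exists (C%:R `^ k%:R^-1) => [|N N0]; first exact: powR_ge0.
have N1 : 1 <= N%:R :> R by rewrite ler1n.
rewrite [u + e + e]addrC [_ `^ (e + _)]powRD; last first.
  by rewrite (gt_eqF (lt_le_trans ltr01 N1)) implybT.
rewrite mulrA ler_wpM2r ?powR_ge0//.
have -> : (size (divisors N))%:R = (size (divisors N) ^ k)%:R `^ k%:R^-1 :> R.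
  by rewrite natrX -powR_mulrn// -powRrM mulfV ?pnatr_eq0// powRr1.
apply: (@le_trans _ _ ((C * N)%:R `^ k%:R^-1)).
  by apply: ge0_ler_powR; rewrite ?nnegrE ?invr_ge0 ?ler0n// ler_nat CP.
by rewrite natrM powRM ?ler0n// ler_wpM2l ?powR_ge0// ler_powR.
Qed.

End Counting.

(** * Counting a list by fibers *)

Section Fibers.
Variables (T U : eqType) (f : T -> U).

Lemma size_sum_fibers (s : seq T) (r : seq U) : uniq r ->
  (forall x, x \in s -> f x \in r) ->
  size s = \sum_(u <- r) count (fun x => f x == u) s.
Proof.
move=> ur; elim: s => [|x s IHs] fr; first by rewrite big1.
rewrite /= big_split /= -IHs => [|y ys]; last by rewrite fr ?inE ?ys ?orbT.
rewrite -add1n; congr addn.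
transitivity (count_mem (f x) r); first by rewrite count_uniq_mem// fr ?mem_head.
rewrite -sum1_count big_mkcond; apply: eq_bigr => u _.
by rewrite /= [u == _]eq_sym; case: (f x == u).
Qed.

Lemma size_le_fibers (s : seq T) k :
  (forall u, (count (fun x => f x == u) s <= k)%N) ->
  (size s <= k * size (undup (map f s)))%N.
Proof.
move=> fk; rewrite (@size_sum_fibers s _ (undup_uniq (map f s))); last first.
  by move=> x xs; rewrite mem_undup map_f.
apply: leq_trans (leq_sum (E2 := fun=> k) _ _) _ => [u _|]; first exact: fk.
by rewrite big_const_seq count_predT iter_addn addn0.
Qed.
End Fibers.

(** * From torsion classes to radical fields *)

Section TorsionFields.
Variables (K : fieldExtType rat) (iota : {rmorphism K -> algC}) (l : nat).
Local Notation n := (\dim {:K}).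
Hypothesis l_prime : prime l.

(** Requiring [f] to extend the fixed [iota] lets radicands with the same [M] be compared over one
    copy of [K]. *)
Definition radical_image (a : K) (M : set algC) D :=
  exists (L : fieldExtType rat) (f : {rmorphism L -> algC})
    (j : {rmorphism K -> L}) (g : L),
    [/\ \dim {:L} = (l * n)%N, forall x, f (j x) = iota x,
        g ^+ l = j (l%:R * a), forall k, g <> j k & M = range f /\ abs_disc L = D].

Lemma radical_image_number_field a M D :
  radical_image a M D -> number_fields (n * l) D M.
Proof.
move=> [L [f [j [g [dimL _ _ _ [ME DE]]]]]].
by exists L, f; rewrite mulnC.
Qed.

Lemma cong_dvd m d (x y : K) : (d %| m)%N -> cong m x y -> cong d x y.
Proof.
move=> /dvdnP[q ->] [t Ot tE]; exists (t *+ q); last by rewrite -mulrnA.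
by rewrite pmulrn; apply: OKMz.
Qed.

(** Replacing [a] by [b = a * y ^+ l] replaces [g] by [g * j y] and keeps [L]. Making [b] invertible
    modulo [l * D_L] serves both discriminant lemmas: modulo [D_L] for the divisibility, modulo [l]
    for [D > 1]. *)
Lemma radical_image_disc I a M D : torsion_generator l I a ->
  radical_image a M D -> (D %| (l ^ (2 * n) * abs_disc K) ^ l)%N && (1 < D)%N.
Proof.
move=> Ia [L [f [j [g [dimL _ gl gK [_ <-]]]]]].
have D0 := abs_disc_gt0 L; have l1 := prime_gt1 l_prime.
have m1 : (1 < l * abs_disc L)%N by rewrite (leq_trans l1)// leq_pmulr.
have [y [b [b' [y0 bE Ob Ob' bb']]]] :=
  torsion_generator_coprime (prime_gt0 l_prime) Ia m1.
have gyl : (g * j y) ^+ l = j (l%:R * b).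
  by rewrite exprMn gl bE -rmorphXn -rmorphM mulrA.
have gyK k : g * j y <> j k.
  move=> gyk; apply: (gK (k / y)); rewrite fmorph_div -gyk mulfK//.
  by rewrite fmorph_eq0.
have := disc_radical_dvd l_prime Ob Ob' gyl dimL gyK (cong_dvd (dvdn_mull _ _) bb').
move=> -> //=; rewrite ltn_neqAle D0 andbT eq_sym; apply/eqP.
apply: (disc_radical_neq1 l_prime Ob Ob' gyl).
exact: cong_dvd (dvdn_mulr _ _) bb'.
Qed.

(** The common image [M] brings all the roots into one [L]. If the ratio of two of them lay in [K],
    their radicands would differ by an [l]-th power, which forces the indices to agree. *)
Lemma radical_image_multiplicity (T : eqType) (a : T -> K) (D : T -> nat) M
    (s : seq T) : uniq s ->
  (forall c, c \in s -> radical_image (a c) M (D c)) ->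
  (forall c c' d, c \in s -> c' \in s -> a c = d ^+ l * a c' -> c = c') ->
  (size s <= l)%N.
Proof.
case: s => [//|c0 s0]; set s := c0 :: s0 => us sM sinj.
have [L [f [j [g [dimL fj _ _ [ME _]]]]]] := sM c0 (mem_head _ _).
pose c (i : 'I_(size s)) := nth c0 s i.
have cs i : c i \in s by rewrite mem_nth.
have /choice[t tP] (i : 'I_(size s)) : exists t : L,
    t != 0 /\ t ^+ l = j (l%:R * a (c i)).
  have [L' [f' [j' [g' [_ fj' gl' gK' [ME' _]]]]]] := sM _ (cs i).
  have [t _ tE] : range f (f' g') by rewrite -ME ME'; exists g'.
  exists t; split.
    apply/eqP => t0; apply: (gK' 0); apply: (fmorph_inj f').
    by rewrite -tE t0 !rmorph0.
  by apply: (fmorph_inj f); rewrite rmorphXn /= tE -rmorphXn gl' fj fj'.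
apply: (radical_multiplicity l_prime (j := j) dimL (t := t)
  (a := fun i => l%:R * a (c i))) => [i|i|i i' k tk].
- by case: (tP i).
- by case: (tP i).
have l0 : (l%:R : K) != 0.
  by rewrite -(rmorph_nat (in_alg K)) fmorph_eq0 pnatr_eq0 -lt0n prime_gt0.
have cc' : c i = c i'.
  apply: (sinj _ _ k) => //; apply: (mulfI l0).
  apply: (fmorph_inj j); rewrite mulrCA [RHS]rmorphM [j (k ^+ l)]rmorphXn.
  by have [_ <-] := tP i; have [_ <-] := tP i'; rewrite tk exprMn.
by apply/val_inj/eqP; rewrite -(nth_uniq c0 (ltn_ord i) (ltn_ord i') us); apply/eqP.
Qed.

Lemma torsion_size_le (R : realType) (F : nat -> R) (s : seq (set (set K))) :
  (forall D, (1 < D)%N -> (counting (number_fields (n * l) D) <= (F D)%:E)%E) ->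
  uniq s -> (forall c, c \in s -> class_torsion K l c) ->
  (size s)%:R <= 1 + \sum_(D <- divisors ((l ^ (2 * n) * abs_disc K) ^ l) |
    (1 < D)%N) l%:R * F D.
Proof.
move=> FP us sT; have l0 := prime_gt0 l_prime.
have lK0 : (l%:R : K) != 0.
  by rewrite -(rmorph_nat (in_alg K)) fmorph_eq0 pnatr_eq0 -lt0n.
have /choice[p pP] c : exists p : set K * K, class_torsion K l c ->
    c = ideal_class p.1 /\ torsion_generator l p.1 p.2.
  have [/class_torsionP[I [a Ia]]|nT] := pselect (class_torsion K l c).
    by exists (I, a).
  by exists (set0, 0).
have {}pP c : c \in s -> c = ideal_class (p c).1 /\
    torsion_generator l (p c).1 (p c).2 by move=> /sT/pP.
have pinj c c' d : c \in s -> c' \in s -> (p c).2 = d ^+ l * (p c').2 -> c = c'.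
  move=> /pP[cE Ic] /pP[c'E Ic'] /(torsion_generator_inj l0 Ic Ic').
  by rewrite -cE -c'E.
(* A bad class has an [l]-th power as radicand and gives no field. Two bad classes have generators
   whose ratio is an [l]-th power, so they coincide. *)
pose bad c := `[< exists k, l%:R * (p c).2 = k ^+ l >].
have bad1 : (count bad s <= 1)%N.
  rewrite -size_filter; have := filter_uniq bad us.
  have : forall c, c \in [seq c <- s | bad c] -> bad c /\ c \in s.
    by move=> c; rewrite mem_filter => /andP.
  case: [seq c <- s | bad c] => [|c [|c' r]]// Hc uc.
  have [/asboolP[k kE] cs] := Hc c (mem_head _ _).
  have [/asboolP[k' k'E] c's] : bad c' /\ c' \in s.
    by apply: Hc; rewrite in_cons mem_head orbT.
  suff cc' : c = c' by move: uc; rewrite cc' /= mem_head.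
  have [_ [_ a'0 _]] := pP c' c's.
  have k'0 : k' != 0.
    apply: contra_eq_neq k'E => ->; rewrite expr0n gtn_eqF//.
    exact: mulf_neq0.
  apply: (pinj _ _ (k / k')) => //; apply: (mulfI lK0).
  by rewrite mulrCA k'E expr_div_n divfK ?expf_neq0.
pose s' := [seq c <- s | predC bad c].
have s's c : c \in s' -> c \in s by rewrite mem_filter => /andP[].
have /choice[q qP] c : exists q : set algC * nat,
    c \in s' -> radical_image (p c).2 q.1 q.2.
  have [|cs'] := boolP (c \in s'); last by exists (set0, 0%N).
  rewrite mem_filter => /andP[/asboolPn good cs].
  have [k lk|L [f [j [g [dimL fj gl gK]]]]] :=
    radical_field iota l_prime (a := l%:R * (p c).2).
    by apply: good; exists k.
  by exists (range f, abs_disc L) => _; exists L, f, j, g.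
set N0 := ((_ * _) ^ l)%N.
have N0_gt0 : (0 < N0)%N by rewrite expn_gt0 muln_gt0 expn_gt0 l0 abs_disc_gt0.
have qdisc c : c \in s' -> ((q c).2 %| N0)%N && (1 < (q c).2)%N.
  move=> cs'; have [_ Ic] := pP c (s's c cs').
  exact: radical_image_disc Ic (qP c cs').
rewrite -(count_predC bad s) natrD; apply: lerD; first by rewrite lern1.
rewrite -size_filter -/s'.
(* The remaining classes are grouped by discriminant, a divisor of [N0], and then by field, with at
   most [l] classes for each field. *)
rewrite (@size_sum_fibers _ _ (fun c => (q c).2) _ _ (divisors_uniq N0)); last first.
  by move=> c /qdisc/andP[]; rewrite -dvdn_divisors.
rewrite natr_sum [X in _ <= X]big_mkcond; apply: ler_sum => D _.
pose sD := [seq c <- s' | (q c).2 == D].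
rewrite -size_filter -/sD; case: ifPn => D1; last first.
  suff -> : sD = [::] by [].
  apply/eqP; rewrite -[_ == _]negbK -has_filter; apply/hasPn => c cs'.
  by apply: contraNneq D1 => <-; have /andP[] := qdisc c cs'.
have usD : uniq sD by rewrite !filter_uniq.
have sDs c : c \in sD -> c \in s' /\ (q c).2 = D.
  by rewrite mem_filter => /andP[/eqP].
apply: (@le_trans _ _ (l%:R * (size (undup [seq (q c).1 | c <- sD]))%:R)).
  rewrite -natrM ler_nat; apply: size_le_fibers => M.
  rewrite -size_filter; apply: (@radical_image_multiplicity _
    (fun c => (p c).2) (fun c => (q c).2) M).
  - exact: filter_uniq.
  - move=> c; rewrite mem_filter => /andP[/eqP <- cD].
    by have [cs' _] := sDs c cD; apply: qP.
  - move=> c c' d; rewrite mem_filter => /andP[_ cD].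
    rewrite mem_filter => /andP[_ c'D].
    have [cs' _] := sDs c cD; have [c's' _] := sDs c' c'D.
    by apply: pinj; apply: s's.
rewrite ler_wpM2l//; apply: (counting_ge (FP D D1)); first exact: undup_uniq.
move=> M; rewrite mem_undup => /mapP[c cD ->]; have [cs' <-] := sDs c cD.
by apply: radical_image_number_field; apply: qP.
Qed.

End TorsionFields.

(** * Final estimate of the torsion *)

Theorem theorem1p3 (R : realType) (n l : nat) (Delta : R)
    (hn : (2 <= n)%N) (hl : prime l) (hDelta : 0 <= Delta)
    (hyp : forall eps : R, 0 < eps -> exists C : R,
       forall D : nat, (1 < D)%N ->
         (counting (number_fields (n * l) D)
            <= (C * D%:R `^ (Delta + eps))%:E)%E) :
  forall eps : R, 0 < eps -> exists C : R,
    forall K : fieldExtType rat, \dim {:K} = n ->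
      (counting (class_torsion K l)
         <= (C * (abs_disc K)%:R `^ (l%:R * Delta + eps))%:E)%E.
Proof.
move=> eps eps0; have l0 : 0 < (l%:R : R) by rewrite ltr0n prime_gt0.
(* The hypothesis and the divisor bound each cost [e] in the exponent of [N], which is a constant
   times the [l]-th power of [D_K]; and [2 * l * e = eps]. *)
pose e := eps / (2 * l%:R).
have e0 : 0 < e by rewrite divr_gt0// mulr_gt0.
have [C CP] := hyp e e0.
have [C2 C2_ge0 C2P] := powR_divisors_bound hDelta e0.
pose u := Delta + e + e.
have lu : l%:R * u = l%:R * Delta + eps.
  by rewrite /u /e; field; rewrite gt_eqF.
pose Z : R := (l ^ (2 * n * l))%:R `^ u.
(* The summand 1 pays for the class without a field, the power of [D_K] being at least 1; [Z]
   absorbs the constant factor of [N], and the absolute value supplies a nonnegative constant. *)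
exists (1 + l%:R * `|C| * C2 * Z) => K dK; apply: counting_le => s us sT.
have [iota] := embedding_exists K.
pose F (D : nat) := C * D%:R `^ (Delta + e).
have FP D : (1 < D)%N ->
    (counting (number_fields (\dim {:K} * l) D) <= (F D)%:E)%E.
  by rewrite dK; apply: CP.
apply: le_trans (torsion_size_le iota hl FP us sT) _; rewrite dK.
set N := ((_ * _) ^ l)%N.
have D0 := abs_disc_gt0 K.
have N0 : (0 < N)%N by rewrite expn_gt0 muln_gt0 expn_gt0 prime_gt0 ?D0.
have NE : N%:R `^ u = Z * (abs_disc K)%:R `^ (l%:R * Delta + eps).
  rewrite /N expnMn -expnM natrM powRM// -lu powRrM powR_mulrn//.
  by rewrite -natrX.
have D1 : 1 <= (abs_disc K)%:R `^ (l%:R * Delta + eps).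
  rewrite -{1}(powRr0 (abs_disc K)%:R) ler_powR ?ler1n//.
  by rewrite addr_ge0 ?mulr_ge0 ?(ltW eps0).
rewrite mulrDl mul1r lerD// -[_ * Z * _]mulrA -NE -[_ * C2 * _]mulrA.
apply: (@le_trans _ _ (l%:R * `|C| *
    ((size (divisors N))%:R * N%:R `^ (Delta + e)))); last first.
  by rewrite ler_wpM2l ?mulr_ge0// C2P.
have -> : l%:R * `|C| * ((size (divisors N))%:R * N%:R `^ (Delta + e)) =
    \sum_(D <- divisors N) l%:R * `|C| * N%:R `^ (Delta + e).
  by rewrite big_const_seq count_predT iter_addr_0 -[RHS]mulr_natl mulrCA.
(* Each term is bounded by the one for [D = N], since [D] divides [N]. *)
rewrite big_mkcond big_seq [X in _ <= X]big_seq; apply: ler_sum => D.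
rewrite -dvdn_divisors// => DN; case: ifP => _; last first.
  by rewrite !mulr_ge0// powR_ge0.
rewrite -mulrA ler_wpM2l// /F; apply: (@le_trans _ _ (`|C| * D%:R `^ (Delta + e))).
  by rewrite ler_wpM2r ?powR_ge0// ler_norm.
rewrite ler_wpM2l//; apply: ge0_ler_powR; rewrite ?nnegrE//.
  by rewrite addr_ge0// ltW.
by rewrite ler_nat dvdn_leq.
Qed.
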